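(* Let $X$ be a connected graph, and suppose that a group $\Gamma$ acts transitively on the vertex set $V(X)$ by graph automorphisms; fix $o\in V(X)$. Then the following are equivalent: (i) $X$ is hyperbolic. (ii) The action has the $\rho$-Cotlar property for some $\rho>0$. (iii) There exist $\rho>0$ and a bounded-ratio scale sequence $(m_k)_{k\ge1}$ such that the action has the $(\rho,m_k)$-Cotlar property for every $k$. (iv) There exist $\rho>0$ and a bounded-ratio scale sequence $(m_k)_{k\ge1}$ with the following property. For every $k\ge1$, every $h_1,h_2\in\Gamma$, and every $A_1,A_2\subset S_{m_k}(o)$ satisfying $A_1=A_2$ or $\operatorname{dist}(A_1,A_2)\ge4\rho$, put $q=h_1h_2^{-1}$. Given geodesics $\gamma_1=[o,h_1.o]$, $\gamma_2=[o,h_2.o]$, $\gamma_3=[o,q.o]$, $\gamma_4=[o,q^{-1}.o]$, if $$A_1\cap\gamma_1\ne\varnothing,\qquad A_2\cap\gamma_2\neq\varnothing,\qquad |q.o|\ge2m_k+2\rho,$$ then $$\gamma_3\cap A_1^\rho\ne\varnothing\qquad\text{or}\qquad\gamma_4\cap A_2^\rho\neq\varnothing.$$ (v) There exist $\rho>0$ and a bounded-ratio scale sequence $(m_k)_{k\ge1}$ with the following property. For every $k\ge1$, every $h_1,h_2\in\Gamma$, every $a_1,a_2\in S_{m_k}(o)$, and all geodesics $\gamma_1=[o,h_1.o]$, $\gamma_2=[o,h_2.o]$, $\gamma_3=[o,q.o]$, $\gamma_4=[o,q^{-1}.o]$ with $q=h_1h_2^{-1}$, if $$a_1\in\gamma_1,\qquad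 a_2\in\gamma_2,\qquad |h_1h_2^{-1}.o|\ge2m_k+2\rho,$$ then $$\gamma_3\cap B_\rho(a_1)\neq\varnothing\qquad\text{or}\qquad\gamma_4\cap B_\rho(a_2)\neq\varnothing.$$
   Context: $X$ carries its path metric and is viewed as a metric realization with every edge of length one. No properness, freeness or faithfulness of the action is assumed; $\Gamma$ is a discrete group. $[x,y]$ denotes a (chosen) geodesic segment joining $x$ and $y$. $|x|=\operatorname{dist}(o,x)$; $S_m(o)=\{x:|x|=m\}$; $B_r(a)=\{x:\operatorname{dist}(x,a)<r\}$ for $r>0$, $B_0(a)=\{a\}$; $A^r=\{x\in X:\operatorname{dist}(x,A)<r\}=\bigcup_{a\in A}B_r(a)$. $X$ is hyperbolic if for some $\delta$ every side of every geodesic triangle lies in the open $\delta$-neighborhood of the union of the other two sides. A bounded-ratio scale sequence is a strictly increasing sequence of positive integers $(m_k)_{k\ge1}$ with $m_k\to\infty$ and $\sup_{k\ge1}m_{k+1}/m_k<\infty$. For $A\subset X$ and $r\ge0$, $\mathcal L^{\exists}_A=\{g\in\Gamma:\text{some geodesic from } o \text{ to } g.o \text{ meets } A\}$ and $\mathcal L^{\forall,r}_A=\{g\in\Gamma:\text{there exists } a\in A \text{ such that every geodesic from } o\text{ to } g.o\text{ meets } B_r(a)\}$. $\lambda$ is the left regular representation of $\Gamma$; $P_{\mathcal E}$ (for $\mathcal E\subset\Gamma$) is the Fourier projection with $P_{\mathcal E}\lambda_g=\lambda_g$ if $g\in\mathcal E$ and $0$ otherwise; $\mathcal E^{-1}=\{g^{-1}:g\in\mathcal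 E\}$. For $\mathcal A=(A_i)_{i\in I}$ and finitely supported $\varepsilon=(\varepsilon_i)$ with $|\varepsilon_i|\le1$, $$\mathcal H^{\exists}_{\mathcal A,\varepsilon}=\sum_i\varepsilon_iP_{\mathcal L^{\exists}_{A_i}},\quad (\mathcal H^{\exists}_{\mathcal A,\varepsilon})^\circ=\sum_i\overline{\varepsilon_i}P_{(\mathcal L^{\exists}_{A_i})^{-1}},\quad \mathcal H^{\forall,r}_{\mathcal A,\varepsilon}=\sum_i\varepsilon_iP_{\mathcal L^{\forall,r}_{A_i}},\quad (\mathcal H^{\forall,r}_{\mathcal A,\varepsilon})^\circ=\sum_i\overline{\varepsilon_i}P_{(\mathcal L^{\forall,r}_{A_i})^{-1}}.$$ For $\rho\ge0$ and $m\in\mathbb N$, the action has the $(\rho,m)$-Cotlar property if, for every finite family $(A_i)_{i\in I}$ of subsets of $S_m(o)$ with $\mathcal L^{\forall,\rho}_{A_i}\cap\mathcal L^{\forall,\rho}_{A_j}=\varnothing$ for $i\ne j$, every choice $|\varepsilon_i|\le1$, and every $g,h\in\bigcup_i\mathcal L^{\exists}_{A_i}$ with $|gh^{-1}.o|\ge2m+2\rho$, one has, with $H^{\exists}=\mathcal H^{\exists}_{\mathcal A,\varepsilon}$ and $H^{\forall}=\mathcal H^{\forall,\rho}_{\mathcal A,\varepsilon}$, $$\begin{aligned}H^{\exists}(\lambda_g)(H^{\exists})^\circ(\lambda_{h^{-1}})&=H^{\forall}\big(\lambda_g(H^{\forall})^\circ(\lambda_{h^{-1}})\big)+(H^{\forall})^\circ\big(H^{\forall}(\lambda_g)\lambda_{h^{-1}}\big)-(H^{\forall})^\circ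 H^{\forall}(\lambda_g\lambda_{h^{-1}})\\&=H^{\forall}\big(\lambda_g(H^{\exists})^\circ(\lambda_{h^{-1}})\big)+(H^{\forall})^\circ\big(H^{\exists}(\lambda_g)\lambda_{h^{-1}}\big)-(H^{\forall})^\circ H^{\forall}(\lambda_g\lambda_{h^{-1}}).\end{aligned}$$ The action has the $\rho$-Cotlar property if it has the $(\rho,m)$-Cotlar property for every $m\in\mathbb N$. *)

(* Defs.v *)
From HB Require Import structures.
From mathcomp Require Import all_boot all_order all_algebra.
From mathcomp Require Import all_classical all_reals all_analysis.
From mathcomp Require Import complex ring lra.

Set Implicit Arguments.
Unset Strict Implicit.
Unset Printing Implicit Defensive.

Import Order.TTheory GRing.Theory Num.Theory.
Import numFieldNormedType.Exports.

Local Open Scope classical_set_scope.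
Local Open Scope ring_scope.

(* Loops and multiple edges are allowed. The orientation of the edges is only
   used to parametrize them; the graph is undirected (see [adj], [walk]). *)
Record graph := Graph {
  vertex : Type;
  edge : Type;
  src : edge -> vertex;
  tgt : edge -> vertex }.

Section Graph.
Variable X : graph.

Definition adj (u v : vertex X) : Prop :=
  exists e : edge X, (src e = u /\ tgt e = v) \/ (src e = v /\ tgt e = u).

Inductive walk : vertex X -> vertex X -> nat -> Prop :=
| walk_nil u : walk u u 0
| walk_cons u v w n : adj u v -> walk v w n -> walk u w n.+1.

Definition connected_graph : Prop := forall u v, exists n, walk u v n.

End Graph.

(* A left action by graph automorphisms. An automorphism may reverse the
   auxiliary orientation of an edge. *)
Record graph_action (G : groupType) (X : graph) := GraphAction {
  vact :> G -> vertex X -> vertex X;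
  eact : G -> edge X -> edge X;
  vact1 : forall v, vact 1%g v = v;
  vactM : forall g h v, vact (g * h)%g v = vact g (vact h v);
  eact1 : forall e, eact 1%g e = e;
  eactM : forall g h e, eact (g * h)%g e = eact g (eact h e);
  act_incidence : forall g e,
    (src (eact g e) = vact g (src e) /\ tgt (eact g e) = vact g (tgt e)) \/
    (src (eact g e) = vact g (tgt e) /\ tgt (eact g e) = vact g (src e)) }.

Definition vertex_transitive (G : groupType) (X : graph)
    (a : graph_action G X) : Prop :=
  forall u v : vertex X, exists g : G, a g u = v.

Section Realization.
Variables (R : realType) (X : graph).

(* [Inner e t _] is the interior point of [e] at distance [t] from [src e]
   along [e]. *)
Inductive rpoint :=
| Vtx of vertex X
| Inner (e : edge X) (t : R) of 0 < t < 1.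

(* [p] is joined to the vertex [v] by a segment of length [l] contained in the
   closed edge carrying [p]. *)
Definition reaches (p : rpoint) (v : vertex X) (l : R) : Prop :=
  match p with
  | Vtx u => v = u /\ l = 0
  | Inner e t _ => (v = src e /\ l = t) \/ (v = tgt e /\ l = 1 - t)
  end.

Definition same_edge_length (p q : rpoint) (l : R) : Prop :=
  match p, q with
  | Inner e t _, Inner e' t' _ => e = e' /\ l = `|t - t'|
  | _, _ => False
  end.

Definition path_length (p q : rpoint) (l : R) : Prop :=
  (exists v w n l1 l2,
      [/\ reaches p v l1, walk v w n, reaches q w l2 & l = l1 + n%:R + l2])
  \/ same_edge_length p q l.

Definition pdist (p q : rpoint) : R := inf [set l | path_length p q l].

Definition geodesic (p q : rpoint) (c : set rpoint) : Prop :=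
  exists f : R -> rpoint,
    [/\ f 0 = p, f (pdist p q) = q,
        {in `[0, pdist p q] &, forall s t, pdist (f s) (f t) = `|s - t|}
      & c = f @` `[0, pdist p q]].

Definition set_dist (A B : set rpoint) : \bar R :=
  ereal_inf [set (pdist a b)%:E | a in A & b in B].

Definition pball (r : R) (a : rpoint) : set rpoint :=
  if r == 0 then [set a] else [set x | pdist x a < r].

Definition thickening (A : set rpoint) (r : R) : set rpoint :=
  [set x | (set_dist [set x] A < r%:E)%E].

Definition pnorm (o : vertex X) (x : rpoint) : R := pdist (Vtx o) x.

Definition psphere (o : vertex X) (m : nat) : set rpoint :=
  [set x | pnorm o x = m%:R].

Definition hyperbolic : Prop :=
  exists delta : R, forall (x y z : rpoint) (a b c : set rpoint),
    geodesic x y a -> geodesic y z b -> geodesic z x c ->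
    [/\ a `<=` thickening (b `|` c) delta,
        b `<=` thickening (a `|` c) delta
      & c `<=` thickening (a `|` b) delta].

End Realization.

(* The scales are indexed from 0: [m k] is the [(k+1)]-st one. *)
Definition bounded_ratio_scale (R : realType) (m : nat -> nat) : Prop :=
  [/\ {homo m : i j / (i < j)%N},
      forall k, (0 < m k)%N,
      m @ \oo --> \oo
    & (ereal_sup [set ((m k.+1)%:R / (m k)%:R : R)%:E | k in [set: nat]]
        < +oo)%E].

Section RegularRepresentation.
Variables (R : realType) (G : groupType).
Local Notation C := R[i].
Local Notation normc := ComplexField.Normc.normc.

Definition square_summable : {pred G -> C} :=
  fun f => `[< summable [set: G] (fun x => (normc (f x) ^+ 2)%:E) >].

Lemma square_summable_submod_closed : submod_closed square_summable.
Proof.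
split.
  apply/asboolP; rewrite /summable esum1// => x _.
  by rewrite [X in X ^+ 2]ComplexField.Normc.normc0 expr0n abse0.
move=> a f g /asboolP sf /asboolP sg; apply/asboolP.
have sZ (c : R) (u : G -> \bar R) : 0 <= c -> summable [set: G] u ->
    summable [set: G] (fun x => c%:E * u x)%E.
  move=> c0 su; rewrite /summable in su *.
  apply: (@le_lt_trans _ _ (c%:E * \esum_(x in [set: G]) `|u x|)%E).
    rewrite ge_ereal_sup// => _ [F [finF FT] <-].
    under eq_fsbigr do rewrite abseM gee0_abs ?lee_fin//.
    rewrite -ge0_mule_fsumr//; apply: lee_pmul => //.
      by apply: fsume_ge0.
    by apply: ereal_sup_ubound; exists F.
  have : \esum_(x in [set: G]) `|u x|%E \is a fin_num.
    rewrite fin_numElt su andbT (lt_le_trans (ltNyr 0))//; exact: esum_ge0.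
  by move=> /fineK <-; rewrite -EFinM ltry.
have a0 : 0 <= 2 * normc a ^+ 2 by rewrite mulr_ge0// sqr_ge0.
have := summableD (sZ _ _ a0 sf) (sZ 2 _ (ler0n _ _) sg).
apply: le_lt_trans.
apply: le_esum => x _ /=.
have n0 (z : C) : 0 <= normc z by case: z => ? ?; exact: sqrtr_ge0.
rewrite !lee_fin !ger0_norm ?addr_ge0 ?mulr_ge0 ?sqr_ge0//.
have := ComplexField.Normc.normcM a (f x).
set u := normc (a * f x) => uE.
have le1 : normc ((a *: f + g) x) <= u + normc (g x) by exact: le_normcD.
apply: (@le_trans _ _ ((u + normc (g x)) ^+ 2)).
  by rewrite lerXn2r// nnegrE ?addr_ge0 ?n0.
rewrite -mulrA -exprMn -uE.
by have := sqr_ge0 (u - normc (g x)); nra.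
Qed.

HB.instance Definition _ := GRing.isSubmodClosed.Build C (G -> C)
  square_summable square_summable_submod_closed.

Record ell2 := Ell2 {
  ell2_fun :> G -> C;
  _ : ell2_fun \in square_summable }.

HB.instance Definition _ := [isSub for ell2_fun].
HB.instance Definition _ := [Choice of ell2 by <:].
HB.instance Definition _ := [SubChoice_isSubLmodule of ell2 by <:].

Lemma shift_square_summable (g : G) (f : ell2) :
  (fun x => f (g^-1 * x)%g) \in square_summable.
Proof.
case: f => f pf /=; have /asboolP sf := pf; apply/asboolP.
rewrite /summable in sf *; move: sf; rewrite (@reindex_esum _ _ _ [set: G] _ (fun x => g^-1 * x)%g)//.
split=> //.
- by move=> x y _ _ /mulgI.
- by move=> x _; exists (g * x)%g => //; rewrite mulKg.
Qed.

Definition lambda (g : G) : ell2 -> ell2 :=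
  fun f => Ell2 (shift_square_summable g f).

Lemma delta1_square_summable :
  (fun x : G => (x == 1%g)%:R : C) \in square_summable.
Proof.
apply/asboolP; rewrite /summable.
rewrite (esumID [set 1%g]); last by move=> x _; exact: abse_ge0.
rewrite setTI esum_set1 ?abse_ge0// esum1 ?adde0 ?ltry// => x [_ /= /eqP/negbTE ->].
by rewrite [normc _]ComplexField.Normc.normc0 expr0n/= normr0.
Qed.

Definition delta1 : ell2 := Ell2 delta1_square_summable.

(* The operators occurring in the statement lie in the linear span of the
   [lambda g]. The coefficient at [g] of such an operator [T] is
   [T delta1 g], and only finitely many of them are nonzero. *)
Definition fourier_proj (E : set G) (T : ell2 -> ell2) : ell2 -> ell2 :=
  \sum_(g \in E) (T delta1 g *: lambda g).

Lemma fourier_proj_lambda (E : set G) (g : G) :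
  fourier_proj E (lambda g) = if g \in E then lambda g else 0.
Proof.
have coef x : lambda g delta1 x = (x == g)%:R.
  by rewrite /= -(inj_eq (mulgI g)) mulVKg mulg1.
rewrite /fourier_proj; under eq_fsbigr do rewrite coef.
rewrite fsbig_mkcond/= -(fsbig_widen [set g] setT)//=; last first.
  move=> x [_ /= /eqP/negbTE xg]; by rewrite /patch xg scale0r if_same.
by rewrite fsbig_set1 /patch eqxx scale1r.
Qed.

End RegularRepresentation.

Section Cotlar.
Variables (R : realType) (G : groupType) (X : graph).
Variables (a : graph_action G X) (o : vertex X).
Local Notation operator := (ell2 R G -> ell2 R G).

Definition orbit_pt (g : G) : rpoint R X := Vtx R (a g o).

Definition geodesic_to (g : G) (c : set (rpoint R X)) : Prop :=
  geodesic (Vtx R o) (orbit_pt g) c.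

Definition Lexists (A : set (rpoint R X)) : set G :=
  [set g | exists2 c, geodesic_to g c & c `&` A !=set0].

Definition Lforall (r : R) (A : set (rpoint R X)) : set G :=
  [set g | exists2 p, A p &
           forall c, geodesic_to g c -> c `&` pball r p !=set0].

Definition Hop (I : finType) (L : I -> set G) (eps : I -> R[i])
    (T : operator) : operator :=
  \sum_i eps i *: fourier_proj (L i) T.

(* This is the transform [T |-> (Hop L eps T^* )^*] on the span of the
   translations. *)
Definition Hop_circ (I : finType) (L : I -> set G) (eps : I -> R[i])
    (T : operator) : operator :=
  \sum_i (eps i)^* *: fourier_proj [set (g^-1)%g | g in L i] T.

Definition cotlar_at (rho : R) (m : nat) : Prop :=
  forall (I : finType) (A : I -> set (rpoint R X)) (eps : I -> R[i]),
    (forall i, A i `<=` psphere o m) ->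
    (forall i j, i != j ->
       Lforall rho (A i) `&` Lforall rho (A j) = set0) ->
    (forall i, `|eps i| <= 1) ->
    forall g h : G,
      (\bigcup_i Lexists (A i)) g -> (\bigcup_i Lexists (A i)) h ->
      2 * m%:R + 2 * rho <= pnorm o (orbit_pt (g * h^-1)%g) ->
      let lam := @lambda R G in
      let He := Hop (fun i => Lexists (A i)) eps in
      let He' := Hop_circ (fun i => Lexists (A i)) eps in
      let Ha := Hop (fun i => Lforall rho (A i)) eps in
      let Ha' := Hop_circ (fun i => Lforall rho (A i)) eps in
      He (lam g) \o He' (lam h^-1%g)
        = Ha (lam g \o Ha' (lam h^-1%g)) + Ha' (Ha (lam g) \o lam h^-1%g)
          - Ha' (Ha (lam g \o lam h^-1%g))
      /\
      Ha (lam g \o Ha' (lam h^-1%g)) + Ha' (Ha (lam g) \o lam h^-1%g)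
          - Ha' (Ha (lam g \o lam h^-1%g))
        = Ha (lam g \o He' (lam h^-1%g)) + Ha' (He (lam g) \o lam h^-1%g)
          - Ha' (Ha (lam g \o lam h^-1%g)).

Definition cotlar (rho : R) : Prop := forall m : nat, cotlar_at rho m.

End Cotlar.

(* Main.v *)
(* The proof of (v) => (i) works with the graph distance [d] on vertices and
   with intervals [I(x, y) = {p | d x p + d p y = d x y}]. Hyperbolicity is
   equivalent to the existence of [D] such that every [p] in [I(x, y)] is, for
   every [z], within Gromov product [D / 2] of [I(x, z)] or of [I(y, z)]. By
   transitivity (v) says that, at each scale [m], two geodesics issued from [x]
   towards [y] and [z] are close at distance [m] from [x], or the same holds at
   [y]. If they fork at [x], then they are close at [y], and cutting off a
   segment of length [m] at [y] changes the Gromov product of [y] and [z] at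
   [x] by a bounded amount; after finitely many cuts this Gromov product is seen
   to be at most a multiple of [m] as long as [d x y <= K * m]. A point [p] of
   [I(x, y)] must fork from [x] or from [y], whence thinness with a constant
   small compared with the range on which it holds. Such a local estimate at
   arbitrarily large scales of bounded ratio improves any large global thinness
   constant, by induction on that constant for triangles of bounded perimeter.

   In the other direction, the spheres consist of vertices, the operators in
   the Cotlar identity are multiples of one [lambda q], and for disjoint families
   the identity factors as [(e g - f q) * (e h - f q^-1)^* = 0]. *)

Require Import Defs.
From HB Require Import structures.
From mathcomp Require Import all_boot all_order all_algebra.
From mathcomp Require Import all_classical all_reals all_analysis.
From mathcomp Require Import complex zify ring lra.

Set Implicit Arguments.
Unset Strict Implicit.
Unset Printing Implicit Defensive.

Import Order.TTheory GRing.Theory Num.Theory.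
Import numFieldNormedType.Exports.

(** * Forks, thin intervals and the local-to-global argument for an integer distance *)

Section IntervalSpace.
Variables (V : Type) (d : V -> V -> nat).
Hypothesis dC : forall x y, d x y = d y x.
Hypothesis dT : forall x y z, d x z <= d x y + d y z.
Hypothesis dI : forall x y t, t <= d x y ->
  exists2 p, d x p = t & t + d p y = d x y.

Definition between (x p y : V) : Prop := d x p + d p y = d x y.

(** The excess [d p x + d p z - d x z] is twice the Gromov product of [x] and [z] at [p]. Bounding
    it, rather than a distance to an interval, turns the estimates into linear integer
    arithmetic. *)
Definition thin_at (D : nat) (x y z p : V) : Prop :=
  d p x + d p z <= d x z + D \/ d p y + d p z <= d y z + D.

Definition thin_intervals (D : nat) : Prop :=
  forall x y z p, between x p y -> thin_at D x y z p.

Definition corner_dichotomy (r m : nat) : Prop :=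
  forall x y z a a' b b', 2 * m + r <= d x y ->
    d x a = m -> between x a z -> d x a' = m -> between x a' y ->
    d y b = m -> between y b z -> d y b' = m -> between y b' x ->
    d a a' <= r \/ d b b' <= r.

(* If [y] and [z] were close together and far from [x], the point [w] of
   [I(x, y)] at distance [2 * m] from [y] would be nearly between [x] and [z],
   so there is a fork at [w] too, against the dichotomy for [x] and [w]. *)
Lemma fork_far (r m : nat) : corner_dichotomy r m -> r <= m -> 0 < m ->
  forall x y z a a', d x a = m -> between x a y -> d x a' = m ->
  between x a' z -> r < d a a' -> d x y <= d x z -> d y z < m ->
  d x y < 4 * m + r.
Proof.
move=> T rm m0 x y z a a' xa ay xa' az aa' yz yzm.
rewrite ltnNge; apply/negP => far.
rewrite /between in ay az.
have := @dI y a (2 * m); rewrite (dC y a) => /(_ ltac:(lia)) [w yw wa].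
have xw := dT x w y; have xw' := dT x a w.
have [ayw wz] : d a w + 2 * m = d a y /\ m <= d w z.
  by move: (dT y z w); rewrite (dC z w) (dC a w); lia.
have [b wb bz] := dI wz.
have [|b' wb' bx] := @dI w x m; first by rewrite (dC w x) (dC w y) in xw *; lia.
move: (dC w y) (dC w x) (dC a' a) => wy wx a'a.
have [] : d a' a <= r \/ d b b' <= r by apply: (T x w z); rewrite /between; lia.
  lia.
(* The path from [x] to [z] through [b'] and [b] gives [d x z < d x y - m + r <= d x y]. *)
have := dT x b' z; have := dT b' b z; have := dT w y z.
rewrite (dC x b') (dC b' b); lia.
Qed.

(* The induction cuts off a segment of length [m] at [y]; each cut costs [r]. *)
Lemma fork_gromov_product (r m : nat) : corner_dichotomy r m -> r <= m ->
  0 < m -> forall n x y z a a', d x a = m -> between x a y -> d x a' = m ->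
  between x a' z -> r < d a a' -> d x y < 5 * m + r + n * m ->
  d x y + d x z <= d y z + 10 * m + 2 * r + n * r.
Proof.
move=> T rm m0; elim=> [|n IHn] x y z a a' xa ay xa' az aa' xy.
  by have := dT x y z; lia.
have [near|far] := ltnP (d x y) (5 * m + r + n * m).
  by have := IHn _ _ _ _ _ xa ay xa' az aa' near; lia.
(* If [d y z < m], then [fork_far] bounds the shorter of [d x y] and [d x z] by [4 * m + r], so
   [d x y < 5 * m + r]. This is the offset in the hypothesis on [d x y]. *)
have [yzm|myz] := ltnP (d y z) m.
  have [le|lt] := leqP (d x y) (d x z).
    by have := fork_far T rm m0 xa ay xa' az aa' le yzm; lia.
  have := fork_far T rm m0 xa' az xa ay; rewrite (dC a') (dC z).
  by move=> /(_ aa' (ltnW lt) yzm); have := dT x z y; rewrite (dC z); lia.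
rewrite /between in ay az.
have [|y1 yy1 y1a] := @dI y a m; first by rewrite (dC y a); lia.
have [b yb bz] := dI myz.
move: (dT x y1 y) (dT x a y1) (dC y1 y) (dC y1 x) (dC a y1) (dC y a).
move=> h1 h2 e1 e2 e3 e4; move: (dC y x) (dC a' a) => e5 e6.
have [] : d a' a <= r \/ d b y1 <= r by apply: (T x y z); rewrite /between; lia.
  lia.
move=> by1.
have := IHn x y1 z a a' xa _ xa' az aa'; rewrite /between.
have := dT y1 b z; rewrite (dC y1 b); lia.
Qed.

Definition thin_upto (B D : nat) : Prop := forall x y z p, between x p y ->
  d p x <= B -> d p y <= B -> thin_at D x y z p.

(** The points [a] and [a'] at distance [m] from [p] towards [x] and [y] are at least
    [2 * m > 2 * r] apart, so the point [c] towards [z] is farther than [r] from one of them. That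
    fork at [p] has excess at most [10 * m + (K + 2) * r <= 11 * m]. *)
Lemma corner_dichotomy_thin_upto (r m K : nat) : corner_dichotomy r m ->
  r < m -> (K + 2) * r <= m -> thin_upto (K * m) (11 * m).
Proof.
move=> T rm Km x y z p pxy px py; rewrite /thin_at; rewrite /between in pxy.
have m0 : 0 < m by lia.
have [xm|mx] := ltnP (d p x) m.
  by left; have := dT p x z; lia.
have [ym|my] := ltnP (d p y) m.
  by right; have := dT p y z; lia.
have [zm|mz] := ltnP (d p z) m.
  by left; have := dT p z x; rewrite (dC z); lia.
have [a pa ax] := dI mx; have [a' pa' ay] := dI my; have [c pc cz] := dI mz.
have aa' : 2 * m <= d a a'.
  by move: (dT x a y) (dT a a' y); rewrite (dC x a) (dC x p) in pxy *; lia.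
have G := fork_gromov_product T (ltnW rm) m0 (n := K).
rewrite /between in G.
have [ac|ac] := ltnP r (d a c).
  by left; have := G _ _ _ _ _ pa _ pc _ ac; rewrite pa pc; move/(_ x z ax cz); lia.
right; have a'c : r < d a' c by have := dT a c a'; rewrite (dC c); lia.
by have := G _ _ _ _ _ pa' _ pc _ a'c; rewrite pa' pc; move/(_ y z ay cz); lia.
Qed.

Definition thin_perimeter (L D : nat) : Prop := forall x y z p, between x p y ->
  d x y + d y z + d z x <= L -> thin_at D x y z p.

(** As [q] lies at the distance of [x'] from [x], cut off at [z], each alternative of [thin_at]
    bounds [d q x']. On the side of [z] the excess of [x'] is spent as well, whence [2 * D]. *)
Lemma thin_near D x z x' q :
  thin_at D x z x' q -> between x q z -> d x q = minn (d x x') (d x z) ->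
  d x x' + d x' z <= d x z + D -> d q x' <= 2 * D.
Proof.
rewrite /thin_at /between => t b; move: t (dT x x' z) (dC q x) (dC x' z) (dC z x').
lia.
Qed.

(* Here [y] is the point of [I(p, x)] at distance [6 * D] from [p]. The global
   constant [D] provides [q] in [I(x, z)] near [y]; since local thinness does
   not restrict [z], it gives the small constant for [z], [p], [q], and replacing
   [q] by the farther point [x] of an interval through [q] does not increase the
   Gromov product at [p]. *)
Lemma thin_perimeter_side (L B D : nat) (x y z p : V) :
  thin_upto (8 * D) B -> 4 * B < D -> thin_perimeter L D ->
  d x p + d p z + d z x <= L -> between p y x -> d p y = minn (6 * D) (d p x) ->
  d p y + d p z <= d y z + B -> d p x + d p z <= d x z + 4 * B.
Proof.
move=> loc BD per pL pyx py pyz.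
have [small|big] := leqP (d p x) (6 * D).
  move: pyx (dT y x z); rewrite /between (dC y x); lia.
move: py; rewrite (minn_idPl (ltnW big)) => py.
have yx := pyx; rewrite /between in yx.
(* The alternative at [p] is excluded by the last hypothesis, because [d p y = 6 * D]. *)
have xyz : d x y + d y z <= d x z + D.
  have [] := per p x z y pyx.
  - by rewrite (dC p x) (dC x z) (dC z p); lia.
  - by rewrite (dC y p); lia.
  - by rewrite (dC y x); lia.
have [q xq qz] := @dI x z (minn (d x y) (d x z)) (geq_minr _ _).
have xqz : between x q z by rewrite /between; lia.
have qy : d q y <= 2 * D.
  apply: (@thin_near D x z y q) => //; apply: per => //.
  move: (dT x p z) (dC z y) (dC y x) (dC x p) (dT y p z) (dC y p) (dC z x).
  lia.
(* This explains [6 * D]: being within [2 * D] of [y], the point [q] stays in the range of [loc],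
   yet leaves room for points at distance [3 * D] from [p]. *)
have pq : 4 * D <= d p q <= 8 * D.
  by move: (dT p y q) (dT p q y); rewrite (dC y q); lia.
have [|s ps sy] := @dI p y (3 * D); first by lia.
have psq : d p s + d s q <= d p q + B.
  have [||||] := loc p y q s; rewrite /between ?(dC s p); try lia.
  by move: (dC y q); lia.
have sz : d p z + 3 * D <= d s z + B.
  by move: (dT y s z); rewrite (dC y s); lia.
have [|t pt tq] := @dI p q (3 * D); first by lia.
have ts : d t s <= 2 * B.
  have [||||] := loc p q s t; rewrite /between ?(dC t p) ?(dC q s); lia.
have tz : d p z + 3 * D <= d t z + 3 * B.
  by move: (dT s t z); rewrite (dC s t); lia.
(* The alternative at [p] would force [6 * D <= 4 * B]. *)
have tqz : d q t + d t z <= d q z + B.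
  by have [||||] := loc p q z t; rewrite /between ?(dC t p) ?(dC t q); move: (dC t q); lia.
move: (dT p q x) (dT p t q) (dC p x) (dC q x) (dC q t); lia.
Qed.

(** Both arms of the interval are truncated at distance [6 * D] from [p]. Local thinness selects one
    truncated arm, and [thin_perimeter_side] extends its estimate to the whole arm. *)
Lemma thin_perimeter_improve (L B D : nat) :
  thin_upto (8 * D) B -> 4 * B < D -> thin_perimeter L D ->
  thin_perimeter L (4 * B).
Proof.
move=> loc BD per x y z p pxy pL.
have [x' px' x'x] := @dI p x (minn (6 * D) (d p x)) (geq_minr _ _).
have [y' py' y'y] := @dI p y (minn (6 * D) (d p y)) (geq_minr _ _).
rewrite /between in pxy.
have [||||] := loc x' y' z p; rewrite /between.
- move: (dT x x' y) (dT x' y' y) (dT x' p y') (dC x x') (dC x' p) (dC x p); lia.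
- by lia.
- by lia.
- move=> h; left; apply: (thin_perimeter_side loc BD per _ _ px' h).
    by move: (dT p y z) (dC y z) (dC z x); lia.
  by rewrite /between; lia.
- move=> h; right; apply: (thin_perimeter_side loc BD per _ _ py' h).
    by move: (dT p x z) (dC y z) (dC z x) (dC x p) (dC y p); lia.
  by rewrite /between; lia.
Qed.

(* The scale is chosen so that the local thinness constant [11 * m] is small
   compared with the current constant [D], while [thin_upto] reaches beyond
   [8 * D]. *)
Theorem corner_dichotomy_thin_intervals (r C m0 : nat) (S : nat -> Prop) :
  (forall m, S m -> corner_dichotomy r m) ->
  (forall M, m0 <= M -> exists2 m, S m & m <= M < C * m) ->
  exists D, thin_intervals D.
Proof.
move=> dich scale.
pose K := 352 * C; pose M0 := m0 + C * ((K + 2) * r + r + 1).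
pose D0 := 44 * M0 + 44.
(* [D0] does not depend on [L], so it serves all triangles. *)
suff per L : thin_perimeter L D0.
  by exists D0 => x y z p /per /(_ (leqnn _)).
suff : forall n, thin_perimeter L (D0 + n) -> thin_perimeter L D0.
  (* The induction starts from [D0 + L], since the excess at [p] never exceeds the perimeter. *)
  move=> /(_ L); apply.
  move=> x y z p pxy pL; left; rewrite /between in pxy.
  by move: (dT p x z) (dC x p) (dT x z y) (dC z x) (dC z y); lia.
elim=> [|n IHn]; first by rewrite addn0.
move=> per; apply: IHn; set D := D0 + n in per *; rewrite addnS -/D in per.
(* From [44 * m <= D] follows [4 * (11 * m) < D.+1], and from [D < 44 * C * m] follows
   [8 * D.+1 <= 352 * C * m = K * m]. *)
have [|m Sm /andP[mM Mm]] := scale (D %/ 44); first by rewrite /D /D0 /M0; lia.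
have mlarge : (K + 2) * r + r + 1 <= m.
  have : C * ((K + 2) * r + r + 1) < C * m.
    by apply: leq_ltn_trans Mm; rewrite /D /D0 /M0; lia.
  by rewrite ltn_mul2l => /andP[_ /ltnW].
have DKm : 8 * D.+1 <= K * m by move: Mm; rewrite /K -mulnA; lia.
have loc : thin_upto (8 * D.+1) (11 * m).
  move=> x y z p pxy px py.
  apply: (corner_dichotomy_thin_upto (K := K) (dich _ Sm)) => //.
  - by rewrite (leq_trans _ mlarge)// addn1 ltnS leq_addl.
  - by rewrite (leq_trans _ mlarge)// -addnA leq_addr.
  - exact: leq_trans px DKm.
  - exact: leq_trans py DKm.
have := thin_perimeter_improve loc _ per; move=> /(_ ltac:(lia)) {}per x y z p pxy pL.
by have [] := per x y z p pxy pL; [left|right]; lia.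
Qed.

(** Otherwise thinness puts [u] near [I(z, y)] and [v] near [I(z, x)]; adding the two estimates
    gives [d x y <= 2 * m + D]. *)
Lemma thin_opposite_corners (D m : nat) (x y z u v : V) : thin_intervals D ->
  between x u z -> between y v z -> d x u = m -> d y v = m ->
  2 * m + D < d x y ->
  d x u + d u y <= d x y + D \/ d y v + d v x <= d y x + D.
Proof.
move=> thin xuz yvz xu yv far.
have := thin _ _ y _ xuz; have := thin _ _ x _ yvz.
rewrite /thin_at; move: xuz yvz; rewrite /between.
move: (dT x u y) (dT y v x) (dC u x) (dC v y) (dC x y) (dC z x) (dC z y).
lia.
Qed.

(** A point [q] of the interval lies within [2 * D + e] of [p]; passing from [q] to [p] adds at most
    twice that to the constant [D]. *)
Lemma thin_intervals_coarse (D e : nat) (x y z p : V) : thin_intervals D ->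
  d p x + d p y <= d x y + e -> thin_at (5 * D + 2 * e) x y z p.
Proof.
move=> thin pxy.
have [q xq qy] := @dI x y (minn (d x p) (d x y)) (geq_minr _ _).
have xqy : between x q y by rewrite /between; lia.
have pq : d p q <= 2 * D + e.
  have := thin _ _ p _ xqy; rewrite /thin_at.
  move: (dC x p) (dC q p) (dC q x) (dC y p) (dT x p y); lia.
have := thin _ _ z _ xqy; rewrite /thin_at.
move: (dT p q x) (dT p q y) (dT p q z); lia.
Qed.

End IntervalSpace.

Local Open Scope classical_set_scope.
Local Open Scope ring_scope.

(** * The graph distance on vertices *)

Section GraphDistance.
Variables (X : graph) (conn : connected_graph X).
Implicit Types u v w : vertex X.

Lemma adjC u v : adj u v -> adj v u.
Proof. by move=> [e [h|h]]; exists e; [right|left]. Qed.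

Lemma walk_cat u v w m n : walk u v m -> walk v w n -> walk u w (m + n).
Proof. by elim=> // x y z k xy _ IH /IH; exact: walk_cons. Qed.

Lemma walk_rev u v n : walk u v n -> walk v u n.
Proof.
elim=> [x|x y z k xy _ IH]; first exact: walk_nil.
by rewrite -addn1; apply: walk_cat IH (walk_cons (adjC xy) (walk_nil x)).
Qed.

Lemma walk_split u v n k : (k <= n)%N -> walk u v n ->
  exists2 w, walk u w k & walk w v (n - k).
Proof.
elim: k u v n => [|k IH] u v n kn uv; first by exists u; rewrite ?subn0//; constructor.
case: uv kn => // x y z n' xy yz kn.
have [w yw wz] := IH _ _ _ kn yz.
by exists w; rewrite ?subSS//; apply: walk_cons yw.
Qed.

Lemma ex_walk u v : exists n, `[< walk u v n >].
Proof. by have [n w] := conn u v; exists n; apply/asboolP. Qed.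

Definition gdist u v : nat := ex_minn (ex_walk u v).

Lemma gdist_walk u v : walk u v (gdist u v).
Proof. by rewrite /gdist; case: ex_minnP => n /asboolP. Qed.

Lemma gdist_le u v n : walk u v n -> (gdist u v <= n)%N.
Proof. by move=> w; rewrite /gdist; case: ex_minnP => k _; apply; apply/asboolP. Qed.

Lemma gdistC u v : gdist u v = gdist v u.
Proof. by apply/eqP; rewrite eqn_leq !gdist_le//; apply/walk_rev/gdist_walk. Qed.

Lemma gdistxx u : gdist u u = 0%N.
Proof. by apply/eqP; rewrite -leqn0; apply/gdist_le/walk_nil. Qed.

Lemma gdist_triangle u v w : (gdist u w <= gdist u v + gdist v w)%N.
Proof. by apply/gdist_le/walk_cat; exact: gdist_walk. Qed.

Lemma gdist_interval u v t : (t <= gdist u v)%N ->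
  exists2 p, gdist u p = t & (t + gdist p v = gdist u v)%N.
Proof.
move=> tuv; have [w uw wv] := walk_split tuv (gdist_walk u v).
have := gdist_triangle u w v; have := gdist_le uw; have := gdist_le wv.
by exists w; lia.
Qed.

Lemma gdist_act (G : groupType) (a : graph_action G X) g u v :
  gdist (a g u) (a g v) = gdist u v.
Proof.
have walk_act h u' v' n : walk u' v' n -> walk (a h u') (a h v') n.
  elim=> [w|x w y k [e uw] _ IH]; first exact: walk_nil.
  apply: walk_cons IH; exists (eact a h e).
  by case: (act_incidence a h e) => [[-> ->]|[-> ->]];
    case: uw => [[-> ->]|[-> ->]]; (by left) || by right.
apply/eqP; rewrite eqn_leq !gdist_le//; last exact/walk_act/gdist_walk.
by have := walk_act g^-1%g _ _ _ (gdist_walk (a g u) (a g v));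
  rewrite -!vactM mulVg !vact1.
Qed.

End GraphDistance.

(** * The path metric of the realization *)

Section Realization.
Variables (R : realType) (X : graph) (conn : connected_graph X).
Local Notation gdist := (gdist conn).
Implicit Types (p q : rpoint R X) (u v : vertex X).

Lemma reaches_ge0 p v l : reaches p v l -> 0 <= l.
Proof. by case: p => [u [_ ->]//|e t /andP[t0 t1] /= [] [_ ->]]; lra. Qed.

Lemma reaches_le1 p v l : reaches p v l -> l <= 1.
Proof. by case: p => [u [_ ->]//|e t /andP[t0 t1] /= [] [_ ->]]; lra. Qed.

Lemma ex_reaches p : exists v l, reaches p v l.
Proof. by case: p => [u|e t t01]; [exists u, 0|exists (src e), t; left]. Qed.

Lemma path_length_ge0 p q l : path_length p q l -> 0 <= l.
Proof.
case=> [[v [w [n [l1 [l2 [/reaches_ge0 l10 _ /reaches_ge0 l20 ->]]]]]]|].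
  by rewrite !addr_ge0.
by case: p q => [u|e t ?] [u'|e' t' ?]//= [_ ->].
Qed.

Lemma ex_path_length p q : exists l, path_length p q l.
Proof.
have [v [l pv]] := ex_reaches p; have [w [l' qw]] := ex_reaches q.
have [n vw] := conn v w; exists (l + n%:R + l'); left.
by exists v, w, n, l, l'.
Qed.

Lemma pdist_le p q l : path_length p q l -> pdist p q <= l.
Proof. by move=> pql; apply: ge_inf => //; exists 0 => ? /path_length_ge0. Qed.

Lemma le_pdist p q a : (forall l, path_length p q l -> a <= l) -> a <= pdist p q.
Proof. by move=> h; apply: lb_le_inf => [|l /h//]; exact: ex_path_length. Qed.

Lemma pdist_ge0 p q : 0 <= pdist p q.
Proof. by apply: le_pdist => l /path_length_ge0. Qed.

Lemma path_lengthC p q l : path_length p q l -> path_length q p l.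
Proof.
case=> [[v [w [n [l1 [l2 [pv vw qw ->]]]]]]|].
  left; exists w, v, n, l2, l1; split=> //; first exact: walk_rev.
  by ring.
case: p q => [u|e t ?] [u'|e' t' ?]//= [-> ->]; right => /=.
by rewrite distrC.
Qed.

Lemma pdistC p q : pdist p q = pdist q p.
Proof. by apply/le_anti/andP; split; apply: le_pdist => l /path_lengthC/pdist_le. Qed.

Lemma pdistxx p : pdist p p = 0.
Proof.
apply/le_anti; rewrite pdist_ge0 andbT; apply: pdist_le.
case: p => [u|e t ?]; last by right; rewrite /= subrr normr0.
by left; exists u, u, 0%N, 0, 0; split => //; [constructor|rewrite !addr0].
Qed.

(** Only an inequality holds, because the concatenated path may turn back inside the edge carrying
    [q] and is then shortened. *)
Lemma path_length_cat p q r l l' : path_length p q l -> path_length q r l' ->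
  exists2 l'', path_length p r l'' & l'' <= l + l'.
Proof.
have mixed p0 q0 r0 k k' : path_length p0 q0 k -> same_edge_length q0 r0 k' ->
    exists2 l'', path_length p0 r0 l'' & l'' <= k + k'.
  case: q0 r0 => [?|e t t01] [?|e' t' t01']//.
  move=> [[v [w [n [l1 [l2 [pv vw /= qw ->]]]]]]|same] /= [ee' ->].
    subst e'; case: qw => [[-> ->]|[-> ->]] in vw *.
      exists (l1 + n%:R + t').
        by left; exists v, (src e), n, l1, t'; split => //=; left.
      by have := ler_norm (t' - t); rewrite distrC; lra.
    exists (l1 + n%:R + (1 - t')).
      by left; exists v, (tgt e), n, l1, (1 - t'); split => //=; right.
    by have := ler_norm (t - t'); lra.
  case: p0 same => [?|e0 t0 t00]//= [-> ->]; exists `|t0 - t'|.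
    by right.
  exact: ler_distD.
move=> pq qr; have [qr'|] := qr; last by move/(mixed _ _ _ _ _ pq).
have [pq'|] := path_lengthC pq; last first.
  move=> /(mixed _ _ _ _ _ (path_lengthC qr))[k /path_lengthC pr kl].
  by exists k => //; rewrite addrC.
move: qr' pq' => [v [w [n [l1 [l2 [qv vw rw ->]]]]]].
move=> [v' [w' [n' [l1' [l2' [qv' vw' pw' ->]]]]]].
(* Inside an edge, both paths leave [q] through the same end, or through opposite ends, and then
   [l1 + l1' = 1] pays for crossing the edge. *)
have [k v'v kl] : exists2 k, walk v' v k & k%:R <= l1 + l1'.
  case: q {mixed pq qr} qv qv' => [u|e t t01] /=.
    by move=> [-> ->] [-> ->]; exists 0%N; [constructor|rewrite addr0].
  have /andP[t0 t1] := t01.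
  have st : adj (src e) (tgt e) by exists e; left.
  move=> [[-> ->]|[-> ->]] [[-> ->]|[-> ->]].
  - by exists 0%N; [constructor|lra].
  - by exists 1%N; [apply: walk_cons (adjC st) _; constructor|lra].
  - by exists 1%N; [apply: walk_cons st _; constructor|lra].
  - by exists 0%N; [constructor|lra].
exists (l2' + (n' + (k + n))%:R + l2).
  left; exists w', w, (n' + (k + n))%N, l2', l2; split => //.
  exact: walk_cat (walk_rev vw') (walk_cat v'v vw).
by rewrite !natrD; lra.
Qed.

Lemma pdist_triangle p q r : pdist p r <= pdist p q + pdist q r.
Proof.
rewrite addrC -lerBlDr; apply: le_pdist => l qr; rewrite lerBlDr addrC -lerBlDr.
apply: le_pdist => l' pq; rewrite lerBlDr.
have [l'' pr] := path_length_cat pq qr.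
exact: le_trans (pdist_le pr).
Qed.

Lemma pdist_vtx u v : pdist (Vtx R u) (Vtx R v) = (gdist u v)%:R.
Proof.
apply/le_anti/andP; split.
  apply: pdist_le; left; exists u, v, (gdist u v), 0, 0.
  by split => //; [exact: gdist_walk|rewrite add0r addr0].
apply: le_pdist => l [[v' [w [n [l1 [l2 [/= [-> ->] uw [wv ->] ->]]]]]]|//].
by rewrite add0r addr0 ler_nat gdist_le -?wv.
Qed.

Lemma ex_vtx_near p : exists v, pdist p (Vtx R v) <= 1.
Proof.
have [v [l pv]] := ex_reaches p; exists v.
apply: (le_trans (pdist_le (l := l) _)); last exact: reaches_le1 pv.
left; exists v, v, 0%N, l, 0; split => //; first by constructor.
by rewrite !addr0.
Qed.

(** An interior point with parameter [t] is at distance [n + t] or [n + (1 - t)] from [o] for some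
    natural number [n], which is never an integer. *)
Lemma psphere_vtx o m p : psphere o m p -> exists2 u, p = Vtx R u & gdist o u = m.
Proof.
rewrite /psphere /= /pnorm; case: p => [u|e t t01].
  by rewrite pdist_vtx => /eqP; rewrite eqr_nat => /eqP um; exists u.
have /andP[t0 t1] := t01.
pose a := (gdist o (src e))%:R + t; pose b := (gdist o (tgt e))%:R + (1 - t).
have ea : path_length (Vtx R o) (Inner e t01) a.
  left; exists o, (src e), (gdist o (src e)), 0, t.
  by split => //=; [exact: gdist_walk|left|rewrite add0r].
have eb : path_length (Vtx R o) (Inner e t01) b.
  left; exists o, (tgt e), (gdist o (tgt e)), 0, (1 - t).
  by split => //=; [exact: gdist_walk|right|rewrite add0r].
have absurd (n k : nat) (s : R) : 0 < s < 1 -> n%:R + s = k%:R -> False.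
  move=> /andP[s0 s1] nk; have : (n < k)%N by rewrite -(ltr_nat R) -nk; lra.
  by rewrite -(ler_nat R) -nk -natr1; lra.
have : Num.min a b <= pdist (Vtx R o) (Inner e t01).
  apply: le_pdist => l [[v [w [n [l1 [l2 [/= [-> ->] ow we ->]]]]]]|//].
  have := gdist_le conn ow; rewrite -(ler_nat R) => le.
  rewrite ge_min; case: we => [[wE ->]|[wE ->]]; rewrite wE in le;
    apply/orP; [left|right]; rewrite /a /b; lra.
move=> mle om; exfalso; move: mle; rewrite om ge_min => /orP[h|h].
  have am : a = m%:R by apply/le_anti; rewrite h -om pdist_le.
  by apply: absurd am.
have bm : b = m%:R by apply/le_anti; rewrite h -om pdist_le.
by apply: absurd bm; lra.
Qed.

End Realization.

(** * Geodesics of the realization and shortest walks *)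

Section Geodesics.
Variables (R : realType) (X : graph) (conn : connected_graph X).
Local Notation gdist := (gdist conn).
Implicit Types (p q : rpoint R X) (u v : vertex X) (f : R -> rpoint R X).

(** Paths of speed at most one can be concatenated without any condition on distances, unlike
    isometric parametrizations. *)
Definition lip_path p q (l : R) f : Prop :=
  [/\ f 0 = p, f l = q &
      forall s t, 0 <= s -> s <= t -> t <= l -> pdist (f s) (f t) <= t - s].

(** A strict inequality between two parameters would join [p] to [q] within less than
    [pdist p q]. *)
Lemma lip_path_geodesic p q f : lip_path p q (pdist p q) f ->
  geodesic p q (f @` `[0, pdist p q]).
Proof.
move=> [f0 fl lip]; exists f; split => //.
have mono s t : 0 <= s -> s <= t -> t <= pdist p q -> pdist (f s) (f t) = t - s.
  move=> s0 st tl; apply/le_anti; rewrite lip//=.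
  have := lip 0 s; have := lip t (pdist p q); rewrite f0 fl.
  have := pdist_triangle conn p (f s) q.
  have := pdist_triangle conn (f s) (f t) q.
  by move=> h1 h2 /(_ (le_trans s0 st) tl (lexx _)) h3
    /(_ (lexx _) s0 (le_trans st tl)) h4; lra.
move=> s t; rewrite !in_itv/= => /andP[s0 sl] /andP[t0 tl].
have [st|/ltW ts] := leP s t.
  by rewrite mono// distrC ger0_norm// subr_ge0.
by rewrite (pdistC conn) mono// ger0_norm// subr_ge0.
Qed.

Lemma lip_path_cat p q r a b f g : 0 <= a -> 0 <= b ->
  lip_path p q a f -> lip_path q r b g ->
  lip_path p r (a + b) (fun s => if s <= a then f s else g (s - a)).
Proof.
move=> a0 b0 [f0 fa flip] [g0 gb glip]; split.
- by rewrite a0.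
- case: ifPn => [ab|]; last by rewrite addrAC subrr add0r.
  have b00 : b = 0 by lra.
  by rewrite b00 addr0 fa -g0 -gb b00.
move=> s t s0 st tab; have [ta|at_] := leP t a.
  by rewrite (le_trans st ta) flip.
have [sa|as_] := leP s a; last by apply: (le_trans (glip _ _ _ _ _)); lra.
apply: (le_trans (pdist_triangle conn _ q _)).
have := flip s a s0 sa (lexx _); rewrite fa.
have := glip 0 (t - a) (lexx _); rewrite g0.
have ta0 : 0 <= t - a by lra.
have tab' : t - a <= b by lra.
move=> /(_ ta0 tab'); lra.
Qed.

(** [Inner] needs a proof that its parameter is interior; deciding the boolean provides one, and
    other parameters are sent to the ends. *)
Definition edge_pt (e : edge X) (s : R) : rpoint R X :=
  match Bool.bool_dec (0 < s < 1) true with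
  | left s01 => Inner e s01
  | right _ => if s <= 0 then Vtx R (src e) else Vtx R (tgt e)
  end.

Lemma edge_ptE e s (s01 : 0 < s < 1) : edge_pt e s = Inner e s01.
Proof.
rewrite /edge_pt; case: Bool.bool_dec => // h; congr Inner; exact: bool_irrelevance.
Qed.

Lemma edge_pt0 e : edge_pt e 0 = Vtx R (src e).
Proof.
rewrite /edge_pt; case: Bool.bool_dec => [h|_]; last by rewrite lexx.
by exfalso; move: h; rewrite ltxx.
Qed.

Lemma edge_pt1 e : edge_pt e 1 = Vtx R (tgt e).
Proof.
rewrite /edge_pt; case: Bool.bool_dec => [h|_]; last by rewrite leNgt ltr01.
by exfalso; move: h; rewrite ltxx andbF.
Qed.

Lemma edge_pt_lip e s t : 0 <= s -> s <= t -> t <= 1 ->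
  pdist (edge_pt e s) (edge_pt e t) <= t - s.
Proof.
move=> s0 st t1.
have [->|sN0] := eqVneq s 0; have [->|tN1] := eqVneq t 1.
- rewrite edge_pt0 edge_pt1 subr0; apply: pdist_le; left.
  exists (src e), (tgt e), 1%N, 0, 0; split => //; last by rewrite add0r addr0.
  by apply: walk_cons (walk_nil _); exists e; left.
- have [->|tN0] := eqVneq t 0; first by rewrite (pdistxx conn)  subrr.
  have t01 : 0 < t < 1 by rewrite !lt_neqAle tN1 t1 eq_sym tN0 (le_trans s0).
  rewrite edge_pt0 subr0 (edge_ptE _ t01); apply: pdist_le; left.
  by exists (src e), (src e), 0%N, 0, t; split => //=; [constructor|left|rewrite addr0 add0r].
- have [->|sN1] := eqVneq s 1; first by rewrite (pdistxx conn) subrr.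
  have s01 : 0 < s < 1 by rewrite !lt_neqAle sN1 (le_trans st t1) eq_sym sN0 s0.
  rewrite edge_pt1 (edge_ptE _ s01); apply: pdist_le; left.
  by exists (tgt e), (tgt e), 0%N, (1 - s), 0; split => //=; [right|constructor|rewrite !addr0].
- have s01 : 0 < s < 1.
    by rewrite (lt_neqAle 0) eq_sym sN0 s0 (le_lt_trans st)// lt_neqAle tN1.
  have t01 : 0 < t < 1.
    by rewrite (lt_neqAle t) tN1 t1 andbT (lt_le_trans _ st)// lt_neqAle eq_sym sN0.
  by rewrite (edge_ptE _ s01) (edge_ptE _ t01); apply: pdist_le; right; rewrite /= distrC ger0_norm// subr_ge0.
Qed.

Lemma lip_path_walk u v n : walk u v n ->
  exists f, lip_path (Vtx R u) (Vtx R v) n%:R f.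
Proof.
elim=> [w|x y z k [e xy] _ [f fP]].
  by exists (fun=> Vtx R w); split => // s t _ st _; rewrite (pdistxx conn) subr_ge0.
suff [g gP] : exists g, lip_path (Vtx R x) (Vtx R y) 1 g.
  by eexists; rewrite -natr1 addrC; apply: lip_path_cat gP fP.
case: xy => [[<- <-]|[<- <-]].
  by exists (edge_pt e); split; [exact: edge_pt0|exact: edge_pt1|exact: edge_pt_lip].
exists (fun s => edge_pt e (1 - s)); split; rewrite ?subr0 ?subrr.
- exact: edge_pt1.
- exact: edge_pt0.
by move=> s t s0 st t1; rewrite (pdistC conn); apply: (le_trans (edge_pt_lip _ _ _ _)); lra.
Qed.

Lemma geodesic_through u w v : between gdist u w v ->
  exists2 c, geodesic (Vtx R u) (Vtx R v) c & c (Vtx R w).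
Proof.
move=> uwv; have [f fP] := lip_path_walk (gdist_walk conn u w).
have [g gP] := lip_path_walk (gdist_walk conn w v).
have := lip_path_cat (ler0n _ _) (ler0n _ _) fP gP.
rewrite -natrD uwv -(pdist_vtx R).
move=> /lip_path_geodesic cP; eexists; first exact: cP.
exists (gdist u w)%:R; last by rewrite lexx; case: fP.
by rewrite /= in_itv/= ler0n pdist_vtx ler_nat -uwv leq_addr.
Qed.

Lemma ex_geodesic u v : exists c, geodesic (Vtx R u) (Vtx R v) c.
Proof.
have /geodesic_through[c] : between gdist u u v by rewrite /between gdistxx.
by exists c.
Qed.

Lemma geodesic_dist p q c s t : geodesic p q c -> c s -> c t ->
  pdist s t = `|pdist p s - pdist p t|.
Proof.
move=> [f [f0 fl iso ->]] [s' s'I <-] [t' t'I <-].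
have I0 : 0 \in `[0, pdist p q] by rewrite in_itv/= lexx (pdist_ge0 conn).
have pf x : x \in `[0, pdist p q] -> pdist p (f x) = x.
  move=> xI; rewrite -{1}f0 iso// sub0r normrN ger0_norm//.
  by move: xI; rewrite in_itv/= => /andP[].
by rewrite iso// !pf.
Qed.

Lemma geodesic_sum p q c s : geodesic p q c -> c s ->
  pdist p s + pdist s q = pdist p q.
Proof.
move=> gc cs; have [f [f0 fl iso cE]] := gc.
have cq : c q by rewrite cE; exists (pdist p q) => //=; rewrite in_itv/= lexx (pdist_ge0 conn).
have le : pdist p s <= pdist p q.
  move: cs; rewrite cE => -[t tI <-].
  have := tI; rewrite /= in_itv/= => /andP[t0 tl].
  rewrite -{1}f0 iso; first by rewrite sub0r normrN ger0_norm.
    by rewrite in_itv/= lexx (pdist_ge0 conn).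
  by rewrite in_itv/= t0.
have := geodesic_dist gc cs cq; rewrite distrC ger0_norm ?subr_ge0//.
by move=> ->; rewrite addrC subrK.
Qed.

Lemma geodesic_pt p q c t : geodesic p q c -> 0 <= t -> t <= pdist p q ->
  exists2 s, c s & pdist p s = t.
Proof.
move=> [f [f0 fl iso ->]] t0 tl.
have tI : t \in `[0, pdist p q] by rewrite in_itv/= t0.
exists (f t); first by exists t.
rewrite -{1}f0 iso ?sub0r ?normrN ?ger0_norm//.
by rewrite in_itv/= lexx (pdist_ge0 conn).
Qed.

Lemma geodesic_between u v c w : geodesic (Vtx R u) (Vtx R v) c -> c (Vtx R w) ->
  between gdist u w v.
Proof.
move=> gc cw; apply/eqP; rewrite -(eqr_nat R) natrD -!pdist_vtx; apply/eqP.
exact: geodesic_sum gc cw.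
Qed.

Lemma geodesic_vtx u v c m : geodesic (Vtx R u) (Vtx R v) c ->
  (m <= gdist u v)%N -> exists w,
  [/\ c (Vtx R w), gdist u w = m & between gdist u w v].
Proof.
move=> gc mu; have [|s cs sm] := geodesic_pt gc (ler0n _ m).
  by rewrite (pdist_vtx R conn) ler_nat.
have [w sE uw] := psphere_vtx conn sm.
by rewrite sE in cs; exists w; split => //; apply: geodesic_between gc cs.
Qed.

Lemma thickeningP (A : set (rpoint R X)) (r : R) p :
  thickening A r p <-> exists2 q, A q & pdist p q < r.
Proof.
rewrite /thickening /= /set_dist; split.
  by move=> /ereal_inf_lt[_ [_ -> [q Aq <-]]]; rewrite lte_fin; exists q.
move=> [q Aq pq]; apply: (@le_lt_trans _ _ (pdist p q)%:E); last by rewrite lte_fin.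
by apply: ereal_inf_lbound; exists p => //; exists q.
Qed.

Lemma pball_gt0 (r : R) p : 0 < r -> pball r p = [set q | pdist q p < r].
Proof. by rewrite /pball => /gt_eqF ->. Qed.

End Geodesics.

Lemma ex_nat_ge (R : realType) (r : R) : exists n : nat, r <= n%:R.
Proof.
exists (Num.bound `|r|); apply: le_trans (ler_norm r) _.
exact: ltW (archi_boundP (normr_ge0 r)).
Qed.

(** * Hyperbolicity of the realization and thin intervals of vertices *)

Section Hyperbolicity.
Variables (R : realType) (X : graph) (conn : connected_graph X).
Local Notation gdist := (gdist conn).
Local Notation pdist_triangle := (pdist_triangle conn).
Local Notation pdistC := (pdistC conn).
Local Notation pdist_ge0 := (pdist_ge0 conn).
Local Notation pdist_vtx := (pdist_vtx R conn).
Implicit Types (p q : rpoint R X) (u v : vertex X).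

(** A point of another side within [delta] of [p] has excess zero on that side, so [p] has excess at
    most [2 * delta]. *)
Lemma hyperbolic_thin_intervals : hyperbolic R X ->
  exists D, thin_intervals gdist D.
Proof.
move=> [delta hyp]; have [D leD] := ex_nat_ge (2 * delta).
exists D => x y z p xpy.
have [a ga ap] := geodesic_through R xpy.
have [b gb] := ex_geodesic R conn y z.
have [c gc] := ex_geodesic R conn z x.
have [/(_ _ ap)/thickeningP[s bcs ps] _ _] := hyp _ _ _ _ _ _ ga gb gc.
rewrite /thin_at -!(ler_nat R) !natrD -!pdist_vtx.
case: bcs => [bs|cs]; [right|left].
  have := geodesic_sum conn gb bs; rewrite (pdistC (Vtx R y) s).
  have := pdist_triangle (Vtx R p) s (Vtx R y).
  have := pdist_triangle (Vtx R p) s (Vtx R z); lra.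
have := geodesic_sum conn gc cs; rewrite (pdistC (Vtx R z)) (pdistC (Vtx R z) (Vtx R x)).
have := pdist_triangle (Vtx R p) s (Vtx R x).
have := pdist_triangle (Vtx R p) s (Vtx R z); lra.
Qed.

Lemma pdist_round p q u v : pdist p (Vtx R u) <= 1 -> pdist q (Vtx R v) <= 1 ->
  pdist p q <= (gdist u v)%:R + 2 /\ (gdist u v)%:R <= pdist p q + 2.
Proof.
move=> pu qv; rewrite -pdist_vtx.
have := pdist_triangle p (Vtx R u) q; have := pdist_triangle (Vtx R u) (Vtx R v) q.
have := pdist_triangle (Vtx R u) p (Vtx R v); have := pdist_triangle p q (Vtx R v).
by rewrite (pdistC (Vtx R v) q) (pdistC (Vtx R u) p); split; lra.
Qed.

Lemma thin_intervals_realization D : thin_intervals gdist D ->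
  exists E : R, 0 <= E /\ forall x y z p : rpoint R X,
  pdist x p + pdist p y <= pdist x y ->
  pdist x p + pdist p z <= pdist x z + E \/ pdist y p + pdist p z <= pdist y z + E.
Proof.
move=> thin; exists (5 * D + 18)%:R; split; first exact: ler0n.
move=> x y z p xpy.
have [x' xx'] := ex_vtx_near x; have [y' yy'] := ex_vtx_near y.
have [z' zz'] := ex_vtx_near z; have [p' pp'] := ex_vtx_near p.
have [xy1 xy2] := pdist_round xx' yy'; have [px1 px2] := pdist_round pp' xx'.
have [py1 py2] := pdist_round pp' yy'; have [pz1 pz2] := pdist_round pp' zz'.
have [xz1 xz2] := pdist_round xx' zz'; have [yz1 yz2] := pdist_round yy' zz'.
rewrite (pdistC x p) (pdistC y p) in xpy *.
have : (gdist p' x' + gdist p' y' <= gdist x' y' + 6)%N.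
  by rewrite -(ler_nat R) !natrD; lra.
move=> /(thin_intervals_coarse (@gdistC _ conn) (@gdist_triangle _ conn)
  (@gdist_interval _ conn) z' thin).
rewrite /thin_at -!(ler_nat R) !natrD !natrM => -[h|h]; [left|right]; lra.
Qed.

(** Thinness uses only these two properties of a geodesic, and they pass to the reversed segment
    without reparametrization. *)
Definition spans p q (c : set (rpoint R X)) : Prop :=
  (forall s, c s -> pdist p s + pdist s q = pdist p q) /\
  (forall t, 0 <= t -> t <= pdist p q -> exists2 s, c s & pdist p s = t).

Lemma geodesic_spans p q c : geodesic p q c -> spans p q c.
Proof.
by move=> gc; split=> [s|t]; [exact: geodesic_sum|exact: geodesic_pt].
Qed.

Lemma spansC p q c : spans p q c -> spans q p c.
Proof.
move=> [cs ct]; split=> [s /cs|t t0 tl].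
  by rewrite addrC pdistC [in X in _ + X]pdistC (pdistC q p).
have [||s /[dup] c_s /cs sE ps] := ct (pdist p q - t).
- by rewrite pdistC in tl; lra.
- by lra.
by exists s => //; rewrite pdistC; lra.
Qed.

Lemma spans_near E x z c p : 0 <= E -> spans x z c ->
  (forall s, c s ->
     pdist x s + pdist s p <= pdist x p + E \/ pdist z s + pdist s p <= pdist z p + E) ->
  pdist x p + pdist p z <= pdist x z + E -> exists2 s, c s & pdist p s <= 2 * E.
Proof.
move=> E0 [cs ct] thin xpz.
have [xp xz pz] := And3 (pdist_ge0 x p) (pdist_ge0 x z) (pdist_ge0 p z).
have [||s c_s xs] := ct (Num.min (pdist x p) (pdist x z)).
- by rewrite le_min xp xz.
- by rewrite ge_min lexx orbT.
exists s => //; rewrite pdistC.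
have := cs _ c_s; have := thin _ c_s; rewrite (pdistC z s) (pdistC z p).
by move: xs; case: (leP (pdist x p) (pdist x z)) => h xs [] ? ?; lra.
Qed.

(** The added 1 makes the bound [2 * E] of [spans_near] strict, as open neighborhoods require. *)
Lemma thin_intervals_side E x y z a b c : 0 <= E ->
  (forall x y z p : rpoint R X, pdist x p + pdist p y <= pdist x y ->
     pdist x p + pdist p z <= pdist x z + E \/
     pdist y p + pdist p z <= pdist y z + E) ->
  spans x y a -> spans y z b -> spans z x c ->
  a `<=` thickening (b `|` c) (2 * E + 1).
Proof.
move=> E0 thin [ya _] bb cc p /ya xpy; apply/thickeningP.
have near q r d : spans q r d -> pdist q p + pdist p r <= pdist q r + E ->
    exists2 s, d s & pdist p s < 2 * E + 1.
  move=> dd qpr; have [|s ds ps] := spans_near (p := p) E0 dd _ qpr.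
    by move=> s /(dd.1) qs; apply: thin; rewrite qs.
  by exists s => //; lra.
have [||] := thin x y z p; first by rewrite xpy.
  by move=> /(near _ _ _ (spansC cc))[s cs ps]; exists s => //; right.
by move=> /(near _ _ _ bb)[s bs ps]; exists s => //; left.
Qed.

Lemma thin_intervals_hyperbolic D : thin_intervals gdist D -> hyperbolic R X.
Proof.
move=> /thin_intervals_realization[E [E0 thin]]; exists (2 * E + 1).
move=> x y z a b c /geodesic_spans sa /geodesic_spans sb /geodesic_spans sc.
split; first exact: thin_intervals_side sa sb sc.
  by rewrite setUC; exact: thin_intervals_side sb sc sa.
exact: thin_intervals_side sc sa sb.
Qed.

(** Take the largest scale not exceeding [M]: the next one exceeds [M] and is at most [C] times as
    large. *)
Lemma bounded_ratio_scale_mem (m : nat -> nat) : bounded_ratio_scale R m ->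
  exists C, forall M, (m 0%N <= M)%N ->
    exists2 k, exists i, k = m i & (k <= M < C * k)%N.
Proof.
move=> [incr pos _ bnd].
move: bnd; set s := ereal_sup _ => bnd.
have les k : (((m k.+1)%:R / (m k)%:R)%:E <= s)%E.
  by apply: ereal_sup_ubound; exists k.
have [r rP] : exists r : R, forall k, (m k.+1)%:R <= r * (m k)%:R.
  have sE : (fine s)%:E = s.
    by apply: fineK; rewrite fin_numElt bnd andbT (lt_le_trans _ (les 0%N))// ltNyr.
  by exists (fine s) => k; rewrite -ler_pdivrMr ?ltr0n// -lee_fin sE.
have [C rC] := ex_nat_ge r; exists C => M m0M.
have mk k : (k <= m k)%N.
  by elim: k => // k IH; apply: leq_ltn_trans IH (incr _ _ (ltnSn k)).
have exk : exists k, (m k <= M)%N by exists 0%N.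
have ubk k : (m k <= M)%N -> (k <= M)%N by exact: leq_trans.
case: (ex_maxnP exk ubk) => k mkM maxk; exists (m k); first by exists k.
rewrite mkM /=; apply: (@leq_trans (m k.+1)).
  by rewrite ltnNge; apply/negP => /maxk; rewrite ltnn.
rewrite -(ler_nat R) natrM; apply: le_trans (rP k) _.
by rewrite ler_wpM2r.
Qed.

End Hyperbolicity.

(** * Triangles translated by the group, and membership in [Lforall] *)

Section ActionGeometry.
Variables (R : realType) (G : groupType) (X : graph) (act : graph_action G X).
Variables (o : vertex X) (conn : connected_graph X).
Local Notation gdist := (gdist conn).
Local Notation pdist_vtx := (pdist_vtx R conn).

Lemma between_act g u v w : between gdist u v w ->
  between gdist (act g u) (act g v) (act g w).
Proof. by rewrite /between !gdist_act. Qed.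

Lemma actKV g u : act g^-1%g (act g u) = u.
Proof. by rewrite -vactM mulVg vact1. Qed.

(** The distances of [p] and [w] from [u] differ by less than [rho]; along the geodesic this bounds
    the distance from [p] to [w']. *)
Lemma geodesic_slice (rho : R) (r : nat) u v w w' c p :
  geodesic (Vtx R u) (Vtx R v) c -> c (Vtx R w') -> gdist u w = gdist u w' ->
  c p -> pdist p (Vtx R w) < rho -> 2 * rho <= r%:R -> (gdist w w' <= r)%N.
Proof.
move=> gc cw' ww' cp pw rhor; rewrite -(ler_nat R) -pdist_vtx.
have := geodesic_dist conn gc cp cw'; rewrite (pdist_vtx u w') -ww' -pdist_vtx.
have := pdist_triangle conn (Vtx R u) p (Vtx R w).
have := pdist_triangle conn (Vtx R u) (Vtx R w) p.
have := pdist_triangle conn (Vtx R w) p (Vtx R w').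
rewrite (pdistC conn (Vtx R w) p); move=> h1 h2 h3 e.
suff : pdist p (Vtx R w') <= rho by lra.
by rewrite e ler_norml; apply/andP; split; lra.
Qed.

Lemma ball_dichotomy_corner (rho : R) (m r : nat) : vertex_transitive act ->
  0 < rho -> 2 * rho <= r%:R ->
  (forall (h1 h2 : G) (a1 a2 : rpoint R X),
    psphere o m a1 -> psphere o m a2 -> let q := (h1 * h2^-1)%g in
    forall c1 c2 c3 c4 : set (rpoint R X),
    geodesic_to act o h1 c1 -> geodesic_to act o h2 c2 ->
    geodesic_to act o q c3 -> geodesic_to act o (q^-1)%g c4 ->
    c1 a1 -> c2 a2 -> 2 * m%:R + 2 * rho <= pnorm o (orbit_pt R act o q) ->
    c3 `&` pball rho a1 !=set0 \/ c4 `&` pball rho a2 !=set0) ->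
  corner_dichotomy gdist r m.
Proof.
move=> trans rho0 rhor balls x y z a a' b b' far xa az xa' a'y yb bz yb' b'x.
have [f fx] := trans o x; have [k ky] := trans o y; have [g gz] := trans o z.
(* Translation by [f^-1] takes [x], [y], [z] to [o], [q.o], [h1.o]; a further translation by [q^-1]
   takes them to [q^-1.o], [o], [h2.o]. The four geodesics are thus the sides at the corners [x] and
   [y]. *)
pose q := (f^-1 * k)%g; pose h1 := (f^-1 * g)%g; pose h2 := (q^-1 * h1)%g.
have Fx : act f^-1%g x = o by rewrite -fx actKV.
have Fy : act f^-1%g y = act q o by rewrite vactM ky.
have Fz : act f^-1%g z = act h1 o by rewrite vactM gz.
have Qy : act q^-1%g (act f^-1%g y) = o by rewrite Fy actKV.
have Qz : act q^-1%g (act f^-1%g z) = act h2 o by rewrite Fz -vactM.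
have Qx : act q^-1%g (act f^-1%g x) = act q^-1%g o by rewrite Fx.
have qE : (h1 * h2^-1)%g = q by rewrite /h2 invgM invgK mulgA mulgV mul1g.
have [c1 gc1 ca1] := geodesic_through R (between_act f^-1%g az).
have [c3 gc3 ca3] := geodesic_through R (between_act f^-1%g a'y).
have [c2 gc2 ca2] := geodesic_through R (between_act q^-1%g (between_act f^-1%g bz)).
have [c4 gc4 ca4] := geodesic_through R (between_act q^-1%g (between_act f^-1%g b'x)).
rewrite Fx Fz in gc1; rewrite Fx Fy in gc3.
rewrite Qy Qz in gc2; rewrite Qy Qx in gc4.
have dF u v : gdist (act f^-1%g u) (act f^-1%g v) = gdist u v by exact: gdist_act.
have dQ u v : gdist (act q^-1%g (act f^-1%g u)) (act q^-1%g (act f^-1%g v)) = gdist u v.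
  by rewrite !gdist_act.
have far' : 2 * m%:R + 2 * rho <= pnorm o (orbit_pt R act o q).
  rewrite /pnorm /orbit_pt pdist_vtx -Fy -Fx dF.
  by move: far; rewrite -(ler_nat R) natrD natrM; lra.
have sa : psphere o m (Vtx R (act f^-1%g a)).
  by rewrite /psphere/= /pnorm pdist_vtx -Fx dF xa.
have sb : psphere o m (Vtx R (act q^-1%g (act f^-1%g b))).
  by rewrite /psphere/= /pnorm pdist_vtx -Qy dQ yb.
have := balls h1 h2 _ _ sa sb c1 c2 c3 c4 gc1 gc2; rewrite /= qE.
case/(_ gc3 gc4 ca1 ca2 far') => [[p [c3p]]|[p [c4p]]].
- move=> pa; left; rewrite -dF.
  apply: (geodesic_slice gc3 ca3 _ c3p _ rhor); last by rewrite pball_gt0 in pa.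
  by rewrite -Fx !dF xa xa'.
- move=> pb; right; rewrite -dQ.
  apply: (geodesic_slice gc4 ca4 _ c4p _ rhor); last by rewrite pball_gt0 in pb.
  by rewrite -Qy !dQ yb yb'.
Qed.

Lemma Lforall_thin (rho : R) (D m : nat) (A : set (rpoint R X)) u g :
  thin_intervals gdist D -> (2 * D)%:R < rho -> A (Vtx R u) -> gdist o u = m ->
  (m <= gdist o (act g o))%N ->
  (gdist o u + gdist u (act g o) <= gdist o (act g o) + D)%N -> Lforall act o rho A g.
Proof.
move=> thin Drho Au ou mg oug; exists (Vtx R u) => // c gc.
have [w [cw ow owg]] := geodesic_vtx gc mg.
exists (Vtx R w); split => //; rewrite pball_gt0; last exact: le_lt_trans Drho.
rewrite /= pdist_vtx; apply: le_lt_trans Drho; rewrite ler_nat.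
apply: (thin_near (@gdistC _ conn) (@gdist_triangle _ conn) (thin _ _ u _ owg)) => //.
by rewrite ow ou (minn_idPl mg).
Qed.

Lemma Lexists_vtx (m : nat) (A : set (rpoint R X)) g : A `<=` psphere o m ->
  Lexists act o A g ->
  exists u, [/\ A (Vtx R u), gdist o u = m & between gdist o u (act g o)].
Proof.
move=> Am [c gc [p [cp Ap]]]; have [u pu ou] := psphere_vtx conn (Am _ Ap).
by rewrite pu in cp Ap; exists u; split => //; exact: geodesic_between gc cp.
Qed.

Lemma Lexists_sub_Lforall (rho : R) (D m : nat) (A : set (rpoint R X)) :
  thin_intervals gdist D -> (2 * D)%:R < rho -> A `<=` psphere o m ->
  Lexists act o A `<=` Lforall act o rho A.
Proof.
move=> thin Drho Am g /(Lexists_vtx Am)[u [Au ou oug]].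
rewrite /between in oug.
by apply: (Lforall_thin thin Drho Au ou); rewrite -oug -?ou ?leq_addr.
Qed.

(** Since [q.(h.o) = g.o], the points [u] and [q.v] lie on the sides from [o] and from [q.o] to
    [g.o], and [thin_opposite_corners] applies. The second alternative is translated back by
    [q^-1]. *)
Lemma Lforall_dichotomy (rho : R) (D m : nat) (A B : set (rpoint R X)) g h :
  thin_intervals gdist D -> (2 * D)%:R < rho ->
  A `<=` psphere o m -> B `<=` psphere o m ->
  Lexists act o A g -> Lexists act o B h ->
  2 * m%:R + 2 * rho <= pnorm o (orbit_pt R act o (g * h^-1)%g) ->
  Lforall act o rho A (g * h^-1)%g \/ Lforall act o rho B (g * h^-1)^-1%g.
Proof.
move=> thin Drho Am Bm /(Lexists_vtx Am)[u [Au ou oug]].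
move=> /(Lexists_vtx Bm)[v [Bv ov ovh]]; set q := (g * h^-1)%g => far.
have farN : (2 * m + D < gdist o (act q o))%N.
  move: far; rewrite /pnorm /orbit_pt pdist_vtx -(ltr_nat R) natrD !natrM.
  by move: Drho; rewrite natrM; have := ler0n R D; lra.
have qh : act q (act h o) = act g o by rewrite -vactM /q -mulgA mulVg mulg1.
have qvg := between_act q ovh; rewrite qh in qvg.
have mq : (m <= gdist o (act q o))%N by lia.
have [] := thin_opposite_corners (@gdistC _ conn) (@gdist_triangle _ conn) thin
  oug qvg ou _ farN; first by rewrite gdist_act.
  by move=> ouq; left; apply: (Lforall_thin thin Drho Au ou).
have e w : gdist (act q w) o = gdist w (act q^-1%g o).
  by rewrite -[in RHS](gdist_act conn act q) -vactM mulgV vact1.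
rewrite gdist_act !e => ovq; right; apply: (Lforall_thin thin Drho Bv ov) => //.
by rewrite -e gdistC.
Qed.

(** Points of one geodesic within [rho] of the sphere of radius [m] are less than [2 * rho] apart,
    so a common element would give [pdist p q < 4 * rho]. *)
Lemma Lforall_disjoint (rho : R) (A B : set (rpoint R X)) : 0 < rho ->
  ((4 * rho)%:E <= set_dist A B)%E -> forall m : nat,
  A `<=` psphere o m -> B `<=` psphere o m ->
  Lforall act o rho A `&` Lforall act o rho B = set0.
Proof.
move=> rho0 AB m Am Bm; apply/seteqP; split => // g [[p Ap pg] [q Bq qg]].
have [c gc] := ex_geodesic R conn o (act g o).
have [p' [cp']] := pg c gc; have [q' [cq']] := qg c gc.
rewrite !pball_gt0//= => qq pp.
have : 4 * rho <= pdist p q.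
  rewrite -lee_fin; apply: le_trans AB _.
  by apply: ereal_inf_lbound; exists p => //; exists q.
have op : pdist (Vtx R o) p = m%:R := Am _ Ap.
have oq : pdist (Vtx R o) q = m%:R := Bm _ Bq.
have := pdist_triangle conn p p' q; have := pdist_triangle conn p' q' q.
have := pdist_triangle conn (Vtx R o) p p'.
have := pdist_triangle conn (Vtx R o) p' p.
have := pdist_triangle conn (Vtx R o) q q'.
have := pdist_triangle conn (Vtx R o) q' q.
rewrite (pdistC conn p p') (pdistC conn q q') (geodesic_dist conn gc cp' cq') op oq.
move=> h1 h2 h3 h4 h5 h6 h7.
have : `|pdist (Vtx R o) p' - pdist (Vtx R o) q'| < 2 * rho.
  by rewrite ltr_norml; apply/andP; split; lra.
lra.
Qed.

End ActionGeometry.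

(** * Fourier multipliers on multiples of a translation *)

Section ScalarIdentity.
Variables (R : realType) (G : groupType).
Local Notation C := R[i].
Local Notation lambda := (@lambda R G).
Implicit Types (c : C) (g h : G).

Lemma lambda_delta1 g x : lambda g (delta1 R G) x = (x == g)%:R.
Proof. by rewrite /= -(inj_eq (mulgI g)) mulVKg mulg1. Qed.

Lemma scale_lambda_inj g : injective (fun c => c *: lambda g).
Proof.
move=> c c' /(congr1 (fun T : ell2 R G -> ell2 R G => T (delta1 R G) g)).
have E b : (b *: lambda g) (delta1 R G) g = b.
  by rewrite -[LHS]/(b * lambda g (delta1 R G) g) lambda_delta1 eqxx mulr1.
by rewrite !E.
Qed.

Lemma scale_lambda_comp c c' g h :
  (c *: lambda g) \o (c' *: lambda h) = (c * c') *: lambda (g * h)%g.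
Proof.
apply/funext => f; apply/val_inj/funext => x /=.
rewrite -[LHS]/(c * (c' * f (h^-1 * (g^-1 * x))%g)) -[RHS]/(c * c' * f ((g * h)^-1 * x)%g).
by rewrite invgM mulgA mulrA.
Qed.

Lemma fourier_proj_scale (E : set G) c g :
  fourier_proj E (c *: lambda g) = (c * (g \in E)%:R) *: lambda g.
Proof.
have coef x : (c *: lambda g) (delta1 R G) x = c * (x == g)%:R.
  by rewrite -lambda_delta1.
rewrite /fourier_proj; under eq_fsbigr do rewrite coef.
rewrite fsbig_mkcond/= -(fsbig_widen [set g] setT)//=; last first.
  move=> x [_ /= /eqP/negbTE xg]; by rewrite /patch xg mulr0 scale0r if_same.
rewrite fsbig_set1 /patch eqxx mulr1; case: (g \in E); rewrite ?mulr1//.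
by rewrite mulr0 scale0r.
Qed.

(** This is the eigenvalue of [Hop L eps] at [lambda g]; that of [Hop_circ L eps] is its conjugate
    at [g^-1]. *)
Definition hcoef (I : finType) (L : I -> set G) (eps : I -> C) g : C :=
  \sum_i eps i * (g \in L i)%:R.

Lemma Hop_scale (I : finType) (L : I -> set G) (eps : I -> C) c g :
  Hop L eps (c *: lambda g) = (c * hcoef L eps g) *: lambda g.
Proof.
rewrite /Hop /hcoef mulr_sumr scaler_suml; apply: eq_bigr => i _.
by rewrite fourier_proj_scale scalerA mulrCA.
Qed.

Lemma Hop_circ_scale (I : finType) (L : I -> set G) (eps : I -> C) c g :
  Hop_circ L eps (c *: lambda g) = (c * (hcoef L eps g^-1%g)^*) *: lambda g.
Proof.
rewrite /Hop_circ /hcoef rmorph_sum mulr_sumr scaler_suml; apply: eq_bigr => i _.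
rewrite fourier_proj_scale scalerA mulrCA rmorphM rmorph_nat.
suff -> : (g \in [set x^-1%g | x in L i]) = (g^-1%g \in L i) by [].
apply/idP/idP; rewrite !inE; first by case=> x Lx <-; rewrite invgK.
by move=> Lg; exists g^-1%g => //; rewrite invgK.
Qed.

End ScalarIdentity.

(** * Reduction of the Cotlar identity to scalars *)

Section CotlarScalars.
Variables (R : realType) (G : groupType) (I : finType) (eps : I -> R[i]).
Local Notation C := R[i].
Local Notation lambda := (@lambda R G).
Implicit Types (L : I -> set G) (g h : G).

Lemma Hop_comp_Hop_circ L g h :
  Hop L eps (lambda g) \o Hop_circ L eps (lambda h^-1%g) =
  (hcoef L eps g * (hcoef L eps h)^* ) *: lambda (g * h^-1)%g.
Proof.
rewrite -[lambda g]scale1r -[lambda h^-1%g]scale1r.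
by rewrite Hop_scale Hop_circ_scale scale_lambda_comp !mul1r invgK.
Qed.

Lemma Hop_lambda_Hop_circ L L' g h :
  Hop L eps (lambda g \o Hop_circ L' eps (lambda h^-1%g)) =
  ((hcoef L' eps h)^* * hcoef L eps (g * h^-1)%g) *: lambda (g * h^-1)%g.
Proof.
rewrite -[lambda g]scale1r -[lambda h^-1%g]scale1r.
by rewrite Hop_circ_scale scale_lambda_comp Hop_scale !mul1r invgK.
Qed.

Lemma Hop_circ_Hop_lambda L L' g h :
  Hop_circ L eps (Hop L' eps (lambda g) \o lambda h^-1%g) =
  (hcoef L' eps g * (hcoef L eps (g * h^-1)^-1%g)^* ) *: lambda (g * h^-1)%g.
Proof.
rewrite -[lambda g]scale1r -[lambda h^-1%g]scale1r.
by rewrite Hop_scale scale_lambda_comp Hop_circ_scale !mul1r mulr1.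
Qed.

Lemma Hop_circ_Hop L g h :
  Hop_circ L eps (Hop L eps (lambda g \o lambda h^-1%g)) =
  (hcoef L eps (g * h^-1)%g * (hcoef L eps (g * h^-1)^-1%g)^* )
    *: lambda (g * h^-1)%g.
Proof.
rewrite -[lambda g]scale1r -[lambda h^-1%g]scale1r.
by rewrite scale_lambda_comp Hop_scale Hop_circ_scale !mul1r.
Qed.

Lemma scaled_identity (T1 T2 T3 T4 T5 T6 : ell2 R G -> ell2 R G)
    (c1 c2 c3 c4 c5 c6 : C) q :
  T1 = c1 *: lambda q -> T2 = c2 *: lambda q -> T3 = c3 *: lambda q ->
  T4 = c4 *: lambda q -> T5 = c5 *: lambda q -> T6 = c6 *: lambda q ->
  (T1 = T2 + T3 - T4 /\ T2 + T3 - T4 = T5 + T6 - T4) <->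
  (c1 = c2 + c3 - c4 /\ c2 + c3 - c4 = c5 + c6 - c4).
Proof.
move=> -> -> -> -> -> ->; rewrite -!scalerDl -!scalerBl.
by split=> [[/scale_lambda_inj-> /scale_lambda_inj->]|[-> ->]].
Qed.

Lemma cotlar_identity L L' g h :
  let q := (g * h^-1)%g in let e := hcoef L eps in let f := hcoef L' eps in
  (Hop L eps (lambda g) \o Hop_circ L eps (lambda h^-1%g)
     = Hop L' eps (lambda g \o Hop_circ L' eps (lambda h^-1%g))
       + Hop_circ L' eps (Hop L' eps (lambda g) \o lambda h^-1%g)
       - Hop_circ L' eps (Hop L' eps (lambda g \o lambda h^-1%g)) /\
   Hop L' eps (lambda g \o Hop_circ L' eps (lambda h^-1%g))
       + Hop_circ L' eps (Hop L' eps (lambda g) \o lambda h^-1%g)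
       - Hop_circ L' eps (Hop L' eps (lambda g \o lambda h^-1%g))
     = Hop L' eps (lambda g \o Hop_circ L eps (lambda h^-1%g))
       + Hop_circ L' eps (Hop L eps (lambda g) \o lambda h^-1%g)
       - Hop_circ L' eps (Hop L' eps (lambda g \o lambda h^-1%g))) <->
  (e g * (e h)^* =
     (f h)^* * f q + f g * (f q^-1%g)^* - f q * (f q^-1%g)^* /\
   (f h)^* * f q + f g * (f q^-1%g)^* - f q * (f q^-1%g)^* =
     (e h)^* * f q + e g * (f q^-1%g)^* - f q * (f q^-1%g)^*).
Proof.
move=> q e f; apply: (scaled_identity (q := q)).
- exact: Hop_comp_Hop_circ.
- exact: Hop_lambda_Hop_circ.
- exact: Hop_circ_Hop_lambda.
- exact: Hop_circ_Hop.
- exact: Hop_lambda_Hop_circ.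
- exact: Hop_circ_Hop_lambda.
Qed.

Lemma hcoef_disjoint L i g : (forall j k, j != k -> L j `&` L k = set0) ->
  L i g -> hcoef L eps g = eps i.
Proof.
move=> disj Lig; rewrite /hcoef (bigD1 i)//= mem_set// mulr1 big1 ?addr0// => j ji.
rewrite memNset ?mulr0// => Ljg.
by have : (L j `&` L i) g by []; rewrite disj.
Qed.

End CotlarScalars.

(** * The Cotlar property and the dichotomy for [Lforall] *)

Section CotlarProperty.
Variables (R : realType) (G : groupType) (X : graph) (act : graph_action G X).
Variables (o : vertex X) (conn : connected_graph X).
Local Notation gdist := (gdist conn).
Local Notation C := R[i].

Lemma thin_intervals_cotlar (rho : R) (D : nat) : thin_intervals gdist D ->
  (2 * D)%:R < rho -> cotlar act o rho.
Proof.
move=> thin Drho m I A eps Am disj _ g h [i _ ig] [j _ jh] far; cbv zeta.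
have sub k := Lexists_sub_Lforall (act := act) thin Drho (Am k).
have disjE k l : k != l -> Lexists act o (A k) `&` Lexists act o (A l) = set0.
  by move=> kl; rewrite -subset0 -(disj _ _ kl); apply: setISS; apply: sub.
apply/cotlar_identity.
rewrite (hcoef_disjoint _ disjE ig) (hcoef_disjoint _ disjE jh).
rewrite (hcoef_disjoint _ disj (sub _ _ ig)) (hcoef_disjoint _ disj (sub _ _ jh)).
split=> //.
(* Either the coefficient at [q] is [eps i] or the one at [q^-1] is [eps j], and one factor
   vanishes. *)
have [qA|qA] := Lforall_dichotomy thin Drho (Am i) (Am j) ig jh far;
  rewrite (hcoef_disjoint _ disj qA); ring.
Qed.

Lemma cotlar_at_scalar (rho : R) (m : nat) : cotlar_at act o rho m ->
  forall (I : finType) (A : I -> set (rpoint R X)) (eps : I -> C),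
    (forall i, A i `<=` psphere o m) ->
    (forall i j, i != j ->
       Lforall act o rho (A i) `&` Lforall act o rho (A j) = set0) ->
    (forall i, `|eps i| <= 1) ->
    forall g h : G,
      (\bigcup_i Lexists act o (A i)) g -> (\bigcup_i Lexists act o (A i)) h ->
      2 * m%:R + 2 * rho <= pnorm o (orbit_pt R act o (g * h^-1)%g) ->
  let e := hcoef (fun i => Lexists act o (A i)) eps in
  let f := hcoef (fun i => Lforall act o rho (A i)) eps in
  e g * (e h)^* = (f h)^* * f (g * h^-1)%g + f g * (f (g * h^-1)^-1%g)^*
                  - f (g * h^-1)%g * (f (g * h^-1)^-1%g)^*.
Proof.
move=> cot I A eps Am disj eps1 g h gA hA far e f.
have := cot I A eps Am disj eps1 g h gA hA far; cbv zeta.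
by case/cotlar_identity.
Qed.

(** Let [c1] and [c2] be the coefficients of [eps1 * eps2^*] and [eps2 * eps1^*]. The two brackets
    are [c1 + c2] and ['i * (c2 - c1)], so the combination equals [2 * 'i * c1]. *)
Lemma imaginary_separation (x y z w x' y' z' w' : C) :
  x = x' -> y = y' -> z = z' -> w = w' ->
  'i * (z - z' - (x - x') - (y - y')) - (w - w' - (x - x') - (y - y')) = 0.
Proof. by move=> -> -> -> ->; ring. Qed.

(* The identity is sesquilinear in [eps]. Evaluating it at [(1, 0)], [(0, 1)],
   [(1, 1)] and [(1, 'i)] isolates the coefficient of [eps1 * eps2^*], which
   would be 1 on the left and 0 on the right if both alternatives failed. *)
Lemma cotlar_at_dichotomy (rho : R) (m : nat) (A B : set (rpoint R X)) g h :
  cotlar_at act o rho m -> A `<=` psphere o m -> B `<=` psphere o m ->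
  A = B \/ Lforall act o rho A `&` Lforall act o rho B = set0 ->
  Lexists act o A g -> Lexists act o B h ->
  2 * m%:R + 2 * rho <= pnorm o (orbit_pt R act o (g * h^-1)%g) ->
  Lforall act o rho A (g * h^-1)%g \/ Lforall act o rho B (g * h^-1)^-1%g.
Proof.
move=> /cotlar_at_scalar cot Am Bm AB Ag Bh far.
apply: contrapT => /not_orP[qA qB].
have n1 : `|1 : C| <= 1 by rewrite normr1.
case: AB => [AB|disj].
  (* Two copies of [A] need not be disjoint, so a family with one member is used; the identity then
     reads [1 = 0]. *)
  subst B; have Ag' : (\bigcup_(i : 'I_1) Lexists act o A) g by exists ord0.
  have Ah : (\bigcup_(i : 'I_1) Lexists act o A) h by exists ord0.
  have disj (i j : 'I_1) : i != j ->
      Lforall act o rho A `&` Lforall act o rho A = set0 by rewrite !ord1 eqxx.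
  have := cot 'I_1 (fun=> A) (fun=> 1) (fun=> Am) disj (fun=> n1) g h Ag' Ah far.
  rewrite /hcoef !big_ord1 (memNset qA) (memNset qB) (mem_set Ag) (mem_set Bh).
  rewrite /= !(mulr0n, mulr1n, mul1r) rmorph0 !mulr0 addr0 subr0 rmorph1.
  by move/eqP; rewrite oner_eq0.
pose F b := if b then A else B.
have Fm b : F b `<=` psphere o m by case: b.
have Fdisj b b' : b != b' ->
    Lforall act o rho (F b) `&` Lforall act o rho (F b') = set0.
  by case: b; case: b' => //= _; rewrite setIC.
have Fg : (\bigcup_b Lexists act o (F b)) g by exists true.
have Fh : (\bigcup_b Lexists act o (F b)) h by exists false.
have eqn (x y : C) : `|x| <= 1 -> `|y| <= 1 -> _ := fun x1 y1 =>
  cot bool F (fun b => if b then x else y) Fm Fdisj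
    (fun b => if b return `|if b then x else y| <= 1 then x1 else y1) g h Fg Fh far.
have n0 : `|0 : C| <= 1 by rewrite normr0 ler01.
have ni : `|'i : C| <= 1 by rewrite normCi.
have := eqn _ _ n1 ni; have := eqn _ _ n1 n1.
have := eqn _ _ n0 n1; have := eqn _ _ n1 n0.
rewrite /hcoef !big_bool /F /= (memNset qA) (memNset qB) (mem_set Ag) (mem_set Bh).
rewrite !rmorphD !rmorphM !rmorph_nat /= conjCi => E10 E01 E11 E1i.
have := imaginary_separation E10 E01 E11 E1i.
rewrite [LHS](_ : _ = 2 * 'i); last by ring: (sqrCi C).
by move/eqP; rewrite mulf_eq0 pnatr_eq0 (negbTE (neq0Ci C)).
Qed.

End CotlarProperty.

Lemma succ_bounded_ratio_scale (R : realType) : bounded_ratio_scale R succn.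
Proof.
split=> //.
  rewrite (_ : succn = (fun n => n + 1)%N); first exact: cvg_addnr.
  by apply/funext => n; rewrite addn1.
apply: (@le_lt_trans _ _ 2%:E); last exact: ltry.
apply: ge_ereal_sup => _ [k _ <-]; rewrite lee_fin ler_pdivrMr ?ltr0n//.
by rewrite -natrM ler_nat; lia.
Qed.

Theorem theorem4p4 (R : realType) (X : graph) (G : groupType)
    (act : graph_action G X) (o : vertex X)
    (Xconn : connected_graph X) (act_trans : vertex_transitive act) :
  [<->
    (* (i) *)
    hyperbolic R X;
    (* (ii) *)
    exists2 rho : R, 0 < rho & cotlar act o rho;
    (* (iii) *)
    exists (rho : R) (m : nat -> nat),
      [/\ 0 < rho, bounded_ratio_scale R m
        & forall k, cotlar_at act o rho (m k)];
    (* (iv) *)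
    exists (rho : R) (m : nat -> nat),
      [/\ 0 < rho, bounded_ratio_scale R m
        & forall (k : nat) (h1 h2 : G) (A1 A2 : set (rpoint R X)),
            A1 `<=` psphere o (m k) -> A2 `<=` psphere o (m k) ->
            (A1 = A2 \/ ((4 * rho)%:E <= set_dist A1 A2)%E) ->
            let q := (h1 * h2^-1)%g in
            forall c1 c2 c3 c4 : set (rpoint R X),
              geodesic_to act o h1 c1 -> geodesic_to act o h2 c2 ->
              geodesic_to act o q c3 -> geodesic_to act o (q^-1)%g c4 ->
              A1 `&` c1 !=set0 -> A2 `&` c2 !=set0 ->
              2 * (m k)%:R + 2 * rho <= pnorm o (orbit_pt R act o q) ->
              c3 `&` thickening A1 rho !=set0 \/
              c4 `&` thickening A2 rho !=set0];
    (* (v) *)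
    exists (rho : R) (m : nat -> nat),
      [/\ 0 < rho, bounded_ratio_scale R m
        & forall (k : nat) (h1 h2 : G) (a1 a2 : rpoint R X),
            psphere o (m k) a1 -> psphere o (m k) a2 ->
            let q := (h1 * h2^-1)%g in
            forall c1 c2 c3 c4 : set (rpoint R X),
              geodesic_to act o h1 c1 -> geodesic_to act o h2 c2 ->
              geodesic_to act o q c3 -> geodesic_to act o (q^-1)%g c4 ->
              c1 a1 -> c2 a2 ->
              2 * (m k)%:R + 2 * rho <= pnorm o (orbit_pt R act o q) ->
              c3 `&` pball rho a1 !=set0 \/ c4 `&` pball rho a2 !=set0]].
Proof.
tfae.
- move=> /(hyperbolic_thin_intervals Xconn)[D thin].
  exists (2 * D).+1%:R; first by rewrite ltr0n.
  by apply: thin_intervals_cotlar thin _; rewrite ltr_nat.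
- move=> [rho rho0 cot]; exists rho, succn; split => //.
  exact: succ_bounded_ratio_scale.
- move=> [rho [m [rho0 scale cot]]]; exists rho, m; split => // k h1 h2 A1 A2 A1m A2m.
  move=> AA q c1 c2 c3 c4 g1 g2 g3 g4 A1c A2c far.
  have ex1 : Lexists act o A1 h1 by exists c1 => //; rewrite setIC.
  have ex2 : Lexists act o A2 h2 by exists c2 => //; rewrite setIC.
  have AA' : A1 = A2 \/ Lforall act o rho A1 `&` Lforall act o rho A2 = set0.
    case: AA => [|AA]; [by left|right].
    exact: (Lforall_disjoint act Xconn rho0 AA A1m A2m).
  have near A x c g : Lforall act o rho A g -> geodesic_to act o g c ->
      c `&` thickening A rho !=set0.
    move=> [p Ap gp] /gp[p' [cp']]; rewrite pball_gt0// => pp'.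
    by exists p'; split => //; apply/thickeningP; exists p.
  by have [l|l] := cotlar_at_dichotomy (cot k) A1m A2m AA' ex1 ex2 far;
    [left; exact: near l g3|right; exact: near l g4].
(* Points less than [4 * rho] apart are put into one set [[set a1; a2]]; being within [rho] of the
   wrong point means being within [5 * rho] of the right one. *)
- move=> [rho [m [rho0 scale prop]]]; exists (5 * rho), m; split => //.
    by rewrite mulr_gt0.
  move=> k h1 h2 a1 a2 a1m a2m q c1 c2 c3 c4 g1 g2 g3 g4 ca1 ca2 far.
  have far' : 2 * (m k)%:R + 2 * rho <= pnorm o (orbit_pt R act o q) by lra.
  have rho50 : 0 < 5 * rho by rewrite mulr_gt0.
  have [close|apart] := ltP (pdist a1 a2) (4 * rho); last first.
    have A1m : [set a1] `<=` psphere o (m k) by move=> _ ->.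
    have A2m : [set a2] `<=` psphere o (m k) by move=> _ ->.
    have AA : ((4 * rho)%:E <= set_dist [set a1] [set a2])%E.
      by apply: le_ereal_inf_tmp => _ [_ -> [_ -> <-]]; rewrite lee_fin.
    have [||[p [cp /thickeningP[_ -> pa]]]|[p [cp /thickeningP[_ -> pa]]]] :=
      prop k h1 h2 _ _ A1m A2m (or_intror AA) _ _ _ _ g1 g2 g3 g4 _ _ far'.
    + by exists a1.
    + by exists a2.
    + by left; exists p; split => //; rewrite pball_gt0//=; lra.
    + by right; exists p; split => //; rewrite pball_gt0//=; lra.
  have Am : [set a1; a2] `<=` psphere o (m k) by move=> _ [] ->.
  have := pdistC Xconn a1 a2.
  have [||[p [cp /thickeningP[_ [] -> pa]]]|[p [cp /thickeningP[_ [] -> pa]]]] :=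
    prop k h1 h2 _ _ Am Am (or_introl erefl) _ _ _ _ g1 g2 g3 g4 _ _ far'.
  + by exists a1; split => //; left.
  + by exists a2; split => //; right.
  + by left; exists p; split => //; rewrite pball_gt0//=; lra.
  + left; exists p; split => //; rewrite pball_gt0//=.
    by have := pdist_triangle Xconn p a2 a1; lra.
  + right; exists p; split => //; rewrite pball_gt0//=.
    by have := pdist_triangle Xconn p a1 a2; lra.
  + by right; exists p; split => //; rewrite pball_gt0//=; lra.
(* The fork constant [r] depends on [rho] alone, hence is the same at all scales. *)
- move=> [rho [m [rho0 scale prop]]]; have [r rhor] := ex_nat_ge (2 * rho).
  have [C CP] := bounded_ratio_scale_mem scale.
  have [D thin] : exists D, thin_intervals (gdist Xconn) D.
    apply: (@corner_dichotomy_thin_intervals _ _ (@gdistC _ Xconn)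
      (@gdist_triangle _ Xconn) (@gdist_interval _ Xconn) r C (m 0%N) _ _ CP).
    by move=> _ [k ->]; apply: ball_dichotomy_corner act_trans rho0 rhor (prop k).
  exact: thin_intervals_hyperbolic thin.
Qed.
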